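(* There exists a constant $K<\infty$ such that for every positive integer $n$ the following holds. Let $Q$ be a random real symmetric $n\times n$ matrix from the GOE, i.e. the diagonal entries are i.i.d. $N(0,1)$, the off-diagonal entries $(Q_{ij})_{i<j}$ are i.i.d. $N(0,1/2)$, and all these entries are mutually independent. Then $$\mathbb{P}\bigl(\text{the DNN problem }\vartheta(Q)\text{ has a unique optimizer and that optimizer has rank one}\bigr)\ge 1-K\frac{(\ln n)^2}{n^3}.$$ Consequently, with probability at least $1-K(\ln n)^2/n^3$, the DNN relaxation is exact, i.e. $\vartheta(Q)=\min\{x^\top Qx: x\in\Delta^{n-1}\}$, and the standard quadratic program $\min\{x^\top Qx: x\in\Delta^{n-1}\}$ has a unique optimizer.
   Context: $N(0,\sigma^2)$ denotes the normal law with variance $\sigma^2$. $\Delta^{n-1}:=\{x\in\mathbb{R}^n: x\ge 0,\ \mathbf{1}^\top x=1\}$. The DNN (doubly nonnegative) problem is $$\vartheta(Q):=\min\{\langle Q,X\rangle:\ \langle E,X\rangle=1,\ X\succeq0,\ X\ge0\},$$ over symmetric $X\in\mathbb{R}^{n\times n}$, where $E$ is the all-ones matrix, $\langle A,B\rangle=\operatorname{tr}(A^\top B)$, $X\succeq0$ means positive semidefinite and $X\ge 0$ means entrywise nonnegative. An optimizer is a feasible $X$ attaining the minimum. *)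

(* Defs.v *)
From HB Require Import structures.
From mathcomp Require Import all_boot all_order all_algebra.
From mathcomp Require Import all_classical all_reals all_analysis.

Set Implicit Arguments.
Unset Strict Implicit.
Unset Printing Implicit Defensive.

Import Order.TTheory GRing.Theory Num.Theory.
Import numFieldNormedType.Exports.

Local Open Scope classical_set_scope.
Local Open Scope ring_scope.

(* In the programs below the feasible sets are nonempty and compact for 0 < n,
   so that the infimum [min_value] is the attained minimum. *)
Definition minimizer (R : realType) (T : Type) (D : set T) (f : T -> R)
    (x : T) : Prop :=
  D x /\ forall y, D y -> f x <= f y.

Definition min_value (R : realType) (T : Type) (D : set T) (f : T -> R) : R :=
  inf (f @` D).

Definition mxdot (R : realType) (n : nat) (A B : 'M[R]_n) : R :=
  \tr (A^T *m B).

Definition quad_form (R : realType) (n : nat) (Q : 'M[R]_n) (x : 'cV[R]_n) : R :=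
  (x^T *m Q *m x) 0 0.

Definition psdmx (R : realType) (n : nat) (X : 'M[R]_n) : Prop :=
  X^T = X /\ forall v : 'cV[R]_n, 0 <= quad_form X v.

Definition dnn_feasible (R : realType) (n : nat) : set 'M[R]_n :=
  [set X | [/\ mxdot (const_mx 1) X = 1,
               psdmx X
             & forall i j, 0 <= X i j]].

Definition dnn_optimizer (R : realType) (n : nat) (Q X : 'M[R]_n) : Prop :=
  minimizer (@dnn_feasible R n) (mxdot Q) X.

Definition dnn_value (R : realType) (n : nat) (Q : 'M[R]_n) : R :=
  min_value (@dnn_feasible R n) (mxdot Q).

Definition simplex (R : realType) (n : nat) : set 'cV[R]_n :=
  [set x | (forall i, 0 <= x i 0) /\ \sum_i x i 0 = 1].

Definition stqp_optimizer (R : realType) (n : nat) (Q : 'M[R]_n)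
    (x : 'cV[R]_n) : Prop :=
  minimizer (@simplex R n) (quad_form Q) x.

Definition stqp_value (R : realType) (n : nat) (Q : 'M[R]_n) : R :=
  min_value (@simplex R n) (quad_form Q).

Definition dnn_unique_rank_one (R : realType) (n : nat) (Q : 'M[R]_n) : Prop :=
  exists2 X : 'M[R]_n, unique (dnn_optimizer Q) X & \rank X = 1%N.

Definition dnn_exact (R : realType) (n : nat) (Q : 'M[R]_n) : Prop :=
  dnn_value Q = stqp_value Q.

Definition stqp_unique (R : realType) (n : nat) (Q : 'M[R]_n) : Prop :=
  exists! x : 'cV[R]_n, stqp_optimizer Q x.

Definition mutually_independent (d : measure_display) (Omega : measurableType d)
    (R : realType) (P : probability Omega R) (I : finType) (D : {set I})
    (X : I -> {RV P >-> R}) : Prop :=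
  forall (J : {set I}) (A : I -> set R), J \subset D ->
    (forall i, i \in J -> measurable (A i)) ->
    P (\bigcap_(i in [set` J]) (X i @^-1` A i)) =
    (\prod_(i in J) P (X i @^-1` A i))%E.

(* [normal_prob] takes the standard deviation as its second argument. The two
   laws are compared on measurable sets only, since their values on other sets
   carry no meaning. *)
Definition has_normal_law (d : measure_display) (Omega : measurableType d)
    (R : realType) (P : probability Omega R) (X : {RV P >-> R})
    (variance : R) : Prop :=
  forall A : set R, measurable A ->
    distribution P X A = normal_prob 0 (Num.sqrt variance) A.

Definition random_matrix (d : measure_display) (Omega : measurableType d)
    (R : realType) (P : probability Omega R) (n : nat)
    (Q : 'I_n -> 'I_n -> {RV P >-> R}) (w : Omega) : 'M[R]_n :=
  \matrix_(i, j) Q i j w.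

Definition is_GOE (d : measure_display) (Omega : measurableType d)
    (R : realType) (P : probability Omega R) (n : nat)
    (Q : 'I_n -> 'I_n -> {RV P >-> R}) : Prop :=
  [/\ forall w, (random_matrix Q w)^T = random_matrix Q w,
      forall i, has_normal_law (Q i i) 1,
      forall i j : 'I_n, (i < j)%N -> has_normal_law (Q i j) 2^-1
    & mutually_independent [set p : 'I_n * 'I_n | (p.1 <= p.2)%N]
        (fun p => Q p.1 p.2)].

(* Main.v *)
(* For x in the simplex, [x x^T] is feasible for the DNN program, so both programs
   minimize the linear function [X |-> <Q, X>] over a compact set of matrices.

   Uniqueness. As a function of a single entry of Q, the value of such a program is
   concave with bounded slopes, and two minimizers that disagree in that entry force
   a jump of the slope. On a grid of step h at most a constant number of cells carry
   such a jump; these cells are determined by the other entries, hence independent of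
   the given one, which lies in a given cell with probability O(h). So the minimizer
   is almost surely unique.

   Exactness. Call {i, j} an edge if Q i j is smaller than all diagonal entries.
   Entries of Q between distinct components of this graph are at least the value of
   the standard quadratic program, and from a doubly nonnegative matrix of order at
   most 4 one can split off some [x x^T] with x >= 0; hence the relaxation is exact if
   all components have at most 4 vertices.

   Probability. A component with 5 vertices contains a tree with 4 edges, for which
   there are O(n^5) choices. With m the minimum of the diagonal, each edge occurs with
   probability p(m) = P(N(0,1/2) < m), which is O(|m| q(m)^2) for
   q(m) = P(N(0,1) < m). As m is about - sqrt (2 ln n) and n q(m) is about
   exponential, E p(m)^4 = O((ln n)^2 / n^8). *)

Require Import Defs.
From mathcomp Require Import all_boot all_order all_algebra.
From mathcomp Require Import all_classical all_reals all_analysis.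
From mathcomp Require Import measurable_realfun ring lra.

Import Order.TTheory GRing.Theory Num.Theory.
Import numFieldNormedType.Exports.

Local Open Scope classical_set_scope.
Local Open Scope ring_scope.

Set Implicit Arguments.
Unset Strict Implicit.
Unset Printing Implicit Defensive.

(** * Linear minimization over compact sets of matrices *)

Section linear_minimization.
Context {R : realType}.

Lemma mxdotE n (A B : 'M[R]_n) : mxdot A B = \sum_i \sum_j A i j * B i j.
Proof.
rewrite /mxdot /mxtrace exchange_big /=; apply: eq_bigr => i _.
by rewrite mxE; apply: eq_bigr => j _; rewrite mxE.
Qed.

Lemma quad_formE n (A : 'M[R]_n) (v : 'cV[R]_n) :
  quad_form A v = \sum_i \sum_j v i 0 * A i j * v j 0.
Proof.
rewrite /quad_form mxE exchange_big /=; apply: eq_bigr => j _.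
rewrite mxE big_distrl /=; apply: eq_bigr => i _.
by rewrite !mxE.
Qed.

Lemma minimizer_min_value (T : Type) (D : set T) (f : T -> R) x :
  minimizer D f x -> min_value D f = f x.
Proof.
move=> [Dx fx]; apply/eqP; rewrite eq_le; apply/andP; split.
  apply: ge_inf; last by exists x.
  by exists (f x) => _ [y Dy <-]; exact: fx.
by apply: lb_le_inf; [exists (f x), x|move=> _ [y Dy <-]; exact: fx].
Qed.

Lemma mx_continuous (T : topologicalType) m n (f : T -> 'M[R]_(m, n)) :
  (forall i j, continuous (fun x => f x i j)) -> continuous f.
Proof.
move=> fc x A [P Pn PA].
rewrite /nbhs /=.
have : \forall y \near x, forall i j, P i j (f y i j).
  apply: filter_forall => i; apply: filter_forall => j.
  exact: (fc i j x _ (Pn i j)).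
by apply: filterS => y Py; exact: PA.
Qed.

(** Tychonoff's theorem for row vectors, carried over along the continuous reshaping [vec_mx]. *)
Lemma mx_box_compact m n (a b : R) :
  compact [set M : 'M[R]_(m, n) | forall i j, a <= M i j <= b].
Proof.
have := @rV_compact R (m * n) (fun=> `[a, b]%classic) (fun=> @segment_compact R a b).
move=> /(continuous_compact (f := vec_mx)) => vc.
have {}vc : compact [set vec_mx x | x in [set v : 'rV[R]_(m * n)| forall i, `[a, b]%classic
  (v ord0 i)]].
  apply: vc; apply: continuous_subspaceT; apply: mx_continuous => i j.
  under [fun x => _]eq_fun do rewrite mxE.
  exact: coord_continuous.
rewrite (_ : [set M | _] = [set vec_mx x | x in [set v : 'rV[R]_(m * n)| forall i, `[a,
  b]%classic (v ord0 i)]])//.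
apply/seteqP; split => [M Mab|_ [v vab <-] i j]; last first.
  by rewrite mxE; have := vab (mxvec_index i j); rewrite /= in_itv.
exists (mxvec M); last exact: mxvecK.
by move=> i; case/mxvec_indexP: i => i j; rewrite /= mxvecE in_itv /=.
Qed.

Lemma sum_continuous (T : topologicalType) (I : Type) (s : seq I) (f : I -> T -> R) :
  (forall i, continuous (f i)) -> continuous (fun x => \sum_(i <- s) f i x).
Proof.
move=> fc; apply: (@continuous_big R I +%R 0 xpredT) => // x.
exact: add_continuous.
Qed.

Lemma mxdot_continuous n (Q : 'M[R]_n) : continuous (mxdot Q).
Proof.
rewrite (_ : mxdot Q = (fun X => \sum_i \sum_j Q i j * X i j)); last first.
  by apply/funext => X; rewrite mxdotE.
apply: sum_continuous => i; apply: sum_continuous => j x.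
by apply: continuousM; [exact: cst_continuous|exact: coord_continuous].
Qed.

Lemma minimizer_exists n (D : set 'M[R]_n) (Q : 'M[R]_n) :
  compact D -> D !=set0 -> exists X, minimizer D (mxdot Q) X.
Proof.
move=> cD D0.
have [|X] := @compact_EVT_min _ _ (mxdot Q) D D0 cD.
  by apply: continuous_subspaceT; exact: mxdot_continuous.
rewrite inE => DX XD; exists X; split => // Y DY.
by apply: XD; rewrite inE.
Qed.

Lemma coord_le_compact n (D : set 'M[R]_n) i j (r : R) : compact D ->
  compact (D `&` [set X | X i j <= r]).
Proof.
move=> cD; apply: compact_closedI => //.
apply: (@preimage_closed _ _ (fun X : 'M[R]_n => X i j) _ _ (@closed_le R r)) => x _.
exact: coord_continuous.
Qed.

Lemma coord_ge_compact n (D : set 'M[R]_n) i j (r : R) : compact D ->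
  compact (D `&` [set X | r <= X i j]).
Proof.
move=> cD; apply: compact_closedI => //.
apply: (@preimage_closed _ _ (fun X : 'M[R]_n => X i j) _ _ (@closed_ge R r)) => x _.
exact: coord_continuous.
Qed.

(** Both feasible sets lie in this box. The bound 1 on the entries makes the optimal value
    1-Lipschitz in each entry of the cost matrix. *)
Definition box01 n : set 'M[R]_n := [set M | forall i j, 0 <= M i j <= 1].

Lemma min_value_dist_le n (D : set 'M[R]_n) (Q Y : 'M[R]_n) :
  compact D -> D !=set0 -> D `<=` @box01 n ->
  min_value D (mxdot Q) <=
  min_value D (mxdot Y) + \sum_i \sum_j `|Q i j - Y i j|.
Proof.
move=> cD D0 Dbox.
have [X mX] := minimizer_exists Q cD D0.
have [Z mZ] := minimizer_exists Y cD D0.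
rewrite (minimizer_min_value mX) (minimizer_min_value mZ).
apply: (le_trans (mX.2 Z mZ.1)).
rewrite !mxdotE -big_split /=; apply: ler_sum => i _.
rewrite -big_split /=; apply: ler_sum => j _.
have /andP[Z0 Z1] := Dbox _ mZ.1 i j.
rewrite -lerBlDl -mulrBl (le_trans (ler_norm _))// normrM (ger0_norm Z0).
by rewrite ler_piMr.
Qed.

Lemma measurable_le_set d (T : measurableType d) (f g : T -> R) :
  measurable_fun setT f -> measurable_fun setT g ->
  measurable [set w | f w <= g w].
Proof. by move=> mf mg; rewrite -[X in measurable X]setTI; exact: measurable_fun_le. Qed.

Lemma measurable_lt_set d (T : measurableType d) (f g : T -> R) :
  measurable_fun setT f -> measurable_fun setT g ->
  measurable [set w | f w < g w].
Proof.
move=> mf mg; rewrite (_ : [set w | _] = ~` [set w | g w <= f w]).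
  by apply: measurableC; exact: measurable_le_set.
by apply/seteqP; split => w /=; rewrite ltNge => /negP.
Qed.

(* [F] is the infimum of the countably many cones with rational apex above it. *)
Lemma lipschitz_measurable d (T : measurableType d) n
    (q : 'I_n -> 'I_n -> T -> R) (F : 'M[R]_n -> R) :
  (forall i j, measurable_fun setT (q i j)) ->
  (forall Q Y, F Q <= F Y + \sum_i \sum_j `|Q i j - Y i j|) ->
  measurable_fun setT (fun w => F (\matrix_(i, j) q i j w)).
Proof.
move=> mq FL _; apply: (measurability _ (RGenInftyO.measurableE R)) => //.
move=> /= _ [_ [c ->] <-]; rewrite setTI.
pose G (Y : 'M[rat]_n) w := F (map_mx ratr Y) + \sum_i \sum_j `|q i j w - ratr (Y i j)|.
rewrite (_ : _ @^-1` _ = \bigcup_Y [set w | G Y w < c]); last first.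
  apply/seteqP; split => w /=; rewrite in_itv /=; last first.
    move=> [Y _ /=]; apply: le_lt_trans; apply: (le_trans (FL _ (map_mx ratr Y))).
    rewrite lerD2l le_eqVlt; apply/orP; left; apply/eqP.
    by apply: eq_bigr => i _; apply: eq_bigr => j _; rewrite !mxE.
  (* The distance to the rational apex is paid twice, for the value at the apex and for the height
     of the cone. Each payment is at most n^2 e, and the +1 keeps their sum strictly below the
     gap. *)
  move=> Fc; pose e := (c - F (\matrix_(i, j) q i j w)) / (2 * (n%:R ^+ 2 + 1)).
  have e0 : 0 < e.
    by rewrite divr_gt0 ?subr_gt0// mulr_gt0// ltr_wpDl// exprn_ge0.
  have /choice[Y Yq] : forall ij : 'I_n * 'I_n, exists y : rat, `|q ij.1 ij.2 w - ratr y| <= e.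
    move=> [i j] /=.
    have [|y] := @rat_in_itvoo R (q i j w) (q i j w + e); first by rewrite ltrDl.
    rewrite in_itv /= => /andP[y1 y2]; exists y.
    by rewrite ler_norml; apply/andP; split; lra.
  exists (\matrix_(i, j) Y (i, j)) => //=.
  have S : \sum_(i < n) \sum_(j < n) `|q i j w - ratr ((\matrix_(i, j) Y (i, j)) i j)| <=
    n%:R ^+ 2 * e.
    rewrite (_ : n%:R ^+ 2 * e = \sum_(i < n) \sum_(j < n) e); last first.
      rewrite sumr_const card_ord sumr_const card_ord -mulrnA -[RHS]mulr_natl.
      by rewrite natrM expr2.
    by apply: ler_sum => i _; apply: ler_sum => j _; rewrite mxE; exact: (Yq (i, j)).
  apply: (@le_lt_trans _ _ (F (\matrix_(i, j) q i j w) + n%:R ^+ 2 * e + n%:R ^+ 2 * e)).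
    apply: lerD => //; apply: (le_trans (FL _ (\matrix_(i, j) q i j w))); rewrite lerD2l.
    apply: le_trans S; rewrite le_eqVlt; apply/orP; left; apply/eqP.
    by apply: eq_bigr => i _; apply: eq_bigr => j _; rewrite !mxE distrC.
  rewrite -addrA -ltrBrDl.
  have : (c - F (\matrix_(i, j) q i j w)) = e * (2 * (n%:R ^+ 2 + 1)).
    by rewrite /e mulfVK// gt_eqF// mulr_gt0// ltr_wpDl// exprn_ge0.
  move=> ->; move: (e) e0 => e'; nra.
apply: countable_bigcupT_measurable => // Y.
have mG : measurable_fun setT (G Y).
  apply: measurable_funD => //.
  apply: (@measurable_sum) => i; apply: measurable_sum => j.
  by apply: measurableT_comp => //; exact: measurable_funB.
exact: measurable_lt_set mG (measurable_cst c).
Qed.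

Lemma min_value_measurable d (T : measurableType d) n
    (q : 'I_n -> 'I_n -> T -> R) (D : set 'M[R]_n) :
  compact D -> D !=set0 -> D `<=` @box01 n ->
  (forall i j, measurable_fun setT (q i j)) ->
  measurable_fun setT (fun w => min_value D (mxdot (\matrix_(i, j) q i j w))).
Proof.
move=> cD D0 Dbox mq; apply: (lipschitz_measurable (F := fun Q => min_value D (mxdot Q))) =>
  // Q Y.
exact: min_value_dist_le.
Qed.

(** * The optimal value as a function of one entry *)

Definition entry_mask n (i j : 'I_n) (k l : 'I_n) : bool :=
  ((k, l) == (i, j)) || ((k, l) == (j, i)).

(** The positions (i, j) and (j, i) are overwritten together, since in a symmetric random matrix
    they hold the same variable. *)
Definition set_entry n (Q : 'M[R]_n) (i j : 'I_n) (a : R) : 'M[R]_n :=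
  \matrix_(k, l) if entry_mask i j k l then a else Q k l.

(** The derivative of the objective at [X] in the overwritten value; minimizers that disagree here
    force a kink of the optimal value. *)
Definition entry_weight n (i j : 'I_n) (X : 'M[R]_n) : R :=
  \sum_k \sum_l (entry_mask i j k l)%:R * X k l.

Lemma mxdot_set_entry n (Q : 'M[R]_n) i j a X :
  mxdot (set_entry Q i j a) X = mxdot (set_entry Q i j 0) X + a * entry_weight i j X.
Proof.
rewrite !mxdotE /entry_weight mulr_sumr -big_split /=; apply: eq_bigr => k _.
rewrite mulr_sumr -big_split /=; apply: eq_bigr => l _; rewrite !mxE.
by case: entry_mask; rewrite ?mul0r ?mul1r ?add0r ?mulr0 ?addr0.
Qed.

Lemma entry_weight_sym n (i j : 'I_n) (X : 'M[R]_n) : X^T = X ->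
  entry_weight i j X = (i == j)%:R * X i j + (i != j)%:R * (X i j *+ 2).
Proof.
move=> XT; have Xji : X j i = X i j by rewrite -{1}XT mxE.
rewrite /entry_weight pair_bigA /= (bigD1 (i, j))//= /entry_mask !eqxx /= mul1r.
have [<-|ij] := eqVneq i j.
  rewrite mul0r mul1r big1 ?addr0// => -[k l] /= /negbTE ->.
  by rewrite mul0r.
rewrite (bigD1 (j, i)) /=; last by rewrite xpair_eqE eq_sym (negbTE ij).
rewrite eqxx orbT !mul1r mul0r Xji add0r mulr2n big1 ?addr0// => -[k l] /= /andP[/negbTE ->
  /negbTE ->].
by rewrite mul0r.
Qed.

Section slopes.
Context {n : nat} (D : set 'M[R]_n).
Hypothesis cD : compact D.
Hypothesis D0 : D !=set0.
Context (Q : 'M[R]_n) (i j : 'I_n).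
Let f a := min_value D (mxdot (set_entry Q i j a)).
Let g := entry_weight i j.

(** As a minimum of affine functions, [f] is concave with supergradient [g X] at [a], so chords to
    the left of [a] are at least as steep. Adding two optimality inequalities shows that the weight
    of a minimizer does not increase with the entry; then a minimizer at [a2] is tested at [a1]. *)
Lemma slope_ge a1 a2 a X : a1 <= a2 -> a2 <= a ->
  minimizer D (mxdot (set_entry Q i j a)) X -> (a2 - a1) * g X <= f a2 - f a1.
Proof.
move=> a12 a2a mX; have [Y [mY gXY]] : exists Y,
    minimizer D (mxdot (set_entry Q i j a2)) Y /\ g X <= g Y.
  move: a2a; rewrite le_eqVlt => /predU1P[->|a2a]; first by exists X.
  have [Y mY] := minimizer_exists (set_entry Q i j a2) cD D0.
  exists Y; split => //; have := mX.2 _ mY.1; have := mY.2 _ mX.1.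
  rewrite mxdot_set_entry [leRHS]mxdot_set_entry => H1.
  rewrite mxdot_set_entry [leRHS]mxdot_set_entry => H2.
  rewrite -subr_ge0 -(pmulr_rge0 _ (_ : 0 < a - a2)) ?subr_gt0// /g.
  by move: H1 H2; rewrite !mulrBl !mulrBr; lra.
rewrite /f (minimizer_min_value mY).
have [Z mZ] := minimizer_exists (set_entry Q i j a1) cD D0.
rewrite (minimizer_min_value mZ).
have := mZ.2 _ mY.1; rewrite [leRHS]mxdot_set_entry [in X in _ -> X](mxdot_set_entry _ _ _
  a2) => H.
have : (a2 - a1) * g X <= (a2 - a1) * g Y by rewrite ler_wpM2l ?subr_ge0.
by move: H; rewrite /g !mulrBl; lra.
Qed.

(** The mirror image, for chords to the right of [a]. *)
Lemma slope_le a1 a2 a X : a1 <= a2 -> a <= a1 ->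
  minimizer D (mxdot (set_entry Q i j a)) X -> f a2 - f a1 <= (a2 - a1) * g X.
Proof.
move=> a12 a2a mX; have [Y [mY gXY]] : exists Y,
    minimizer D (mxdot (set_entry Q i j a1)) Y /\ g Y <= g X.
  move: a2a; rewrite le_eqVlt => /predU1P[<-|a2a]; first by exists X.
  have [Y mY] := minimizer_exists (set_entry Q i j a1) cD D0.
  exists Y; split => //; have := mX.2 _ mY.1; have := mY.2 _ mX.1.
  rewrite mxdot_set_entry [leRHS]mxdot_set_entry => H1.
  rewrite mxdot_set_entry [leRHS]mxdot_set_entry => H2.
  rewrite -subr_ge0 -(pmulr_rge0 _ (_ : 0 < a1 - a)) ?subr_gt0// /g.
  by move: H1 H2; rewrite !mulrBl !mulrBr; lra.
rewrite /f (minimizer_min_value mY).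
have [Z mZ] := minimizer_exists (set_entry Q i j a2) cD D0.
rewrite (minimizer_min_value mZ).
have := mZ.2 _ mY.1; rewrite [leRHS]mxdot_set_entry [in X in _ -> X](mxdot_set_entry _ _ _
  a1) => H.
have : (a2 - a1) * g Y <= (a2 - a1) * g X by rewrite ler_wpM2l ?subr_ge0.
by move: H; rewrite /g !mulrBl; lra.
Qed.

End slopes.

End linear_minimization.

(** * Almost sure uniqueness of the minimizer *)

Section uniqueness.
Context {R : realType}.

(** * Independence of one entry from all the others *)

Section indep.
Context d (Omega : measurableType d) (P : probability Omega R) (I : finType).
Context (D : {set I}) (X : I -> {RV P >-> R}) (p : I).

(** A pi-system generating the sigma-algebra of the variables indexed by [D] other than [p]. *)
Definition other_cylinders : set (set Omega) :=
  [set S | exists A : I -> set R, (forall i, measurable (A i)) /\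
     S = \bigcap_(i in [set` (D :\ p)]) (X i @^-1` A i)].

Lemma other_cylinders_measurable : other_cylinders `<=` measurable.
Proof.
move=> S [A [mA ->]]; apply: fin_bigcap_measurable => [|i _].
  exact: finite_finset.
rewrite -[X in measurable X]setTI; exact: (measurable_funPT (X i)).
Qed.

(** Both sides are finite measures in [S]. They agree on the pi-system of cylinders by mutual
    independence, hence on the sigma-algebra it generates. *)
Lemma independent_other : p \in D -> mutually_independent D X ->
  forall S B, <<s other_cylinders >> S -> measurable B ->
  P (S `&` X p @^-1` B) = (P S * P (X p @^-1` B))%E.
Proof.
move=> pD XI S B sS mB.
have mXB : measurable (X p @^-1` B).
  by rewrite -[X in measurable X]setTI; exact: (measurable_funPT (X p)).
have fB : 0 <= fine (P (X p @^-1` B)) by apply: fine_ge0.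
have PBE : P (X p @^-1` B) = (fine (P (X p @^-1` B)))%:E.
  by rewrite fineK// fin_num_measure.
pose m1 := mrestr P mXB.
pose m2 := mscale (NngNum fB) P.
have m2E V : m2 V = (P V * P (X p @^-1` B))%E by rewrite muleC PBE.
suff : m1 S = m2 S by rewrite m2E.
apply: (@g_sigma_algebra_measure_unique _ _ _ other_cylinders _ (fun=> setT) _ _ m1 m2) => //.
- exact: other_cylinders_measurable.
- move=> _; exists (fun=> setT); split => //.
  by apply/seteqP; split.
- by rewrite bigcup_const//; exists 0%N.
- move=> _ _ [A [mA ->]] [A' [mA' ->]]; exists (fun i => A i `&` A' i); split.
    by move=> i; exact: measurableI.
  by apply/seteqP; split => [w [H1 H2] i iD|w H]; [split; [exact: H1|exact: H2]|
    split => i iD; have [] := H i iD].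
- move=> _ [A [mA ->]]; rewrite -[RHS]/(m2 _) m2E -[LHS]/(m1 _) /m1 /mrestr.
  (* Inserting [B] at the index [p] turns the left-hand event into a cylinder over all of [D], to
     which independence applies. *)
  pose A' i := if i == p then B else A i.
  have mA' i : measurable (A' i) by rewrite /A'; case: ifP.
  have := XI (D :\ p) A (subsetDl _ _) (fun i _ => mA i) => ->.
  have := XI D A' (subxx _) (fun i _ => mA' i).
  rewrite (big_setD1 p) //= {2}/A' eqxx => H; rewrite muleC.
  under eq_bigr => i iDp.
    rewrite (_ : A i = A' i); last by move: iDp; rewrite !inE /A' => /andP[/negbTE ->].
    over.
  rewrite -H; congr (P _); apply/seteqP; split => w /=.
    move=> [Hw Bw] i /= iD; rewrite /A'; case: eqP => [->//|/eqP ip].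
    by apply: (Hw i); rewrite /= !inE ip.
  move=> Hw; split; last by have := Hw p pD; rewrite /= /A' eqxx.
  by move=> i /=; rewrite !inE => /andP[ip iD]; have := Hw i iD; rewrite /= /A' (negbTE ip).
- by move=> k; rewrite -[ltLHS]/(P (setT `&` X p @^-1` B)) setTI ltey_eq fin_num_measure.
Qed.

Lemma other_measurable q (A : set R) : q \in D -> q != p -> measurable A ->
  <<s other_cylinders >> (X q @^-1` A).
Proof.
move=> qD qp mA; apply: sub_sigma_algebra.
exists (fun i => if i == q then A else setT); split; first by move=> i; case: ifP.
apply/seteqP; split => w /=; first by move=> Aw i _ /=; case: eqP => // ->.
by move=> /(_ q) /=; rewrite !inE eqxx qD qp; exact.
Qed.

End indep.

(** The sum is the expected number of events that occur, and at most [C] of them occur at any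
    point. *)
Lemma sum_probability_le d (T : measurableType d) (P : probability T R) (L : nat)
    (S : nat -> set T) (C : R) :
  (forall l, measurable (S l)) ->
  (forall w, \sum_(l < L) (\1_(S l) w : R) <= C) ->
  (\sum_(l < L) P (S l) <= C%:E)%E.
Proof.
move=> mS SC.
have -> : (\sum_(l < L) P (S l) = \int[P]_w (\sum_(l < L) (\1_(S l) w)%:E))%E.
  rewrite ge0_integral_sum//=.
  - by apply: eq_bigr => l _; rewrite integral_indic// setIT.
  - by move=> l; apply/measurable_EFinP; exact: measurable_indic.
rewrite -[leRHS]mule1 -(probability_setT P) -(integral_cst P measurableT).
apply: ge0_le_integral => //=.
- by move=> w _; rewrite sumEFin lee_fin sumr_ge0.
- by apply: emeasurable_sum => l; apply/measurable_EFinP; exact: measurable_indic.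
- by move=> w _; rewrite sumEFin lee_fin.
Qed.

Lemma entry_weight_bounds n (i j : 'I_n) (X : 'M[R]_n) : @box01 R n X ->
  0 <= entry_weight i j X <= \sum_(k < n) \sum_(l < n) 1.
Proof.
move=> bX; apply/andP; split.
  by apply: sumr_ge0 => k _; apply: sumr_ge0 => l _; have /andP[? ?] := bX k l; rewrite
    mulr_ge0.
apply: ler_sum => k _; apply: ler_sum => l _; have /andP[? ?] := bX k l.
by case: entry_mask; rewrite ?mul1r ?mul0r.
Qed.

(** * Ties between minimizers that disagree in one entry *)

Section null.
Context d (Omega : measurableType d) (P : probability Omega R) (n : nat).
Context (Q : 'I_n -> 'I_n -> {RV P >-> R}) (i j : 'I_n) (D : set 'M[R]_n).
Hypothesis ij : (i <= j)%N.
Hypothesis Qsym : forall w, (random_matrix Q w)^T = random_matrix Q w.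
Hypothesis Qind : mutually_independent [set p : 'I_n * 'I_n | (p.1 <= p.2)%N]
        (fun p => Q p.1 p.2).
Hypothesis cD : compact D.
Hypothesis D0 : D !=set0.
Hypothesis Dbox : D `<=` @box01 R n.

Let G := other_cylinders [set p : 'I_n * 'I_n | (p.1 <= p.2)%N]
        (fun p => Q p.1 p.2) (i, j).

Let F (a : R) (w : Omega) := min_value D (mxdot (set_entry (random_matrix Q w) i j a)).

(** Overwriting the entry (i, j) leaves a function of the other entries. Those below the diagonal
    are read off above it by symmetry. *)
Let F_measurable a : measurable_fun (setT : set (g_sigma_algebraType G)) (F a).
Proof.
pose q k l (w : g_sigma_algebraType G) := if entry_mask i j k l then a else Q k l w.
rewrite (_ : F a = fun w => min_value D (mxdot (\matrix_(k, l) q k l w))); last first.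
  apply/funext => w; rewrite /F; congr (min_value D (mxdot _)).
  by apply/matrixP => k l; rewrite !mxE /q; case: entry_mask.
apply: min_value_measurable => // k l; rewrite /q.
have [kl|kl] := boolP (entry_mask i j k l); first exact: measurable_cst.
move=> _ A mA; rewrite setTI.
wlog kl' : k l kl / (k <= l)%N.
  move=> H; have [|lk] := leqP k l; first exact: H.
  have -> : Q k l @^-1` A = Q l k @^-1` A.
    by apply/seteqP; split => w /=; have := Qsym w => /matrixP/(_ k l); rewrite !mxE => ->.
  apply: H (ltnW lk).
  by move: kl; rewrite /entry_mask !xpair_eqE andbC [X in _ || X]andbC orbC.
apply: (@other_measurable _ _ _ _ _ _ _ (k, l)) => //; first by rewrite inE.
by apply: contra kl; rewrite /entry_mask => ->.
Qed.

(** Cut the range of the entry into [L] cells of length 1/N, each of probability at most c/N. A tie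
    of size [e] with the entry in a given cell forces the jump event [S l], which is independent of
    the entry, and at most [C * 2 / e] of these events occur at once, where [C] is n^2. *)
Lemma entry_gap_le (B : set Omega) (e c r : R) (N L : nat) :
  measurable B -> 0 < e -> 0 <= c -> (0 < N)%N ->
  (forall w, B w -> - r <= Q i j w < - r + L%:R / N%:R) ->
  (forall a : R, (P (Q i j @^-1` `[a, (a + N%:R^-1)%R[%classic) <= (c / N%:R)%:E)%E) ->
  (forall w, B w -> exists X Y, [/\ minimizer D (mxdot (random_matrix Q w)) X,
     minimizer D (mxdot (random_matrix Q w)) Y &
     entry_weight i j X + e <= entry_weight i j Y]) ->
  (P B <= (c / N%:R * ((\sum_(k < n) \sum_(l < n) 1) * 2 / e))%:E)%E.
Proof.
move=> mB e0 c0 N0 Br Pc BXY; set C := \sum_(k < n) _.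
pose dl : R := N%:R^-1.
have dl0 : 0 < dl by rewrite invr_gt0 ltr0n.
(* The grid starts one cell before [- r], so that the cell of the entry, from [b l.+1] to [b l.+2],
   always has a left neighbour. *)
pose b (l : nat) : R := - r + (l%:R - 1) * dl.
have bS l : b l.+1 = b l + dl by rewrite /b -natr1; ring.
have bD l : b l.+1 - b l = dl by rewrite bS addrAC subrr add0r.
have ble l : b l <= b l.+1 by rewrite bS lerDl ltW.
pose df l w := F (b l.+1) w - F (b l) w.
(* The slope drops by at least [e] across the cell from [b l.+1] to [b l.+2]; the entry itself does
   not enter. *)
pose S l := [set w | e * dl <= df l w - df l.+2 w].
have mS l : <<s G >> (S l).
  apply: (@measurable_le_set R _ (g_sigma_algebraType G)); first exact: measurable_cst.
  by apply: measurable_funB; apply: measurable_funB; exact: F_measurable.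
have mS' l : measurable (S l).
  by apply: (smallest_sub _ (@other_cylinders_measurable _ _ _ _ _ _ _) (mS l));
     exact: sigma_algebra_measurable.
(* A minimizer at the common endpoint of two adjacent cells has a weight between their slopes, so
   [df] decreases in [l]. *)
have dfX l w : exists X, [/\ @box01 R n X, dl * entry_weight i j X <= df l w &
    df l.+1 w <= dl * entry_weight i j X].
  have [X mX] := minimizer_exists (set_entry (random_matrix Q w) i j (b l.+1)) cD D0.
  exists X; split; first exact: Dbox mX.1.
    by have := slope_ge cD D0 (ble l) (lexx _) mX; rewrite bD.
  by have := slope_le cD D0 (ble l.+1) (lexx _) mX; rewrite bD.
have df_mono l w : df l.+1 w <= df l w.
  by have [X [_ ? ?]] := dfX l w; apply: le_trans; eassumption.
have df_ge0 l w : 0 <= df l w.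
  have [X [/(entry_weight_bounds i j)/andP[X0 _] /(le_trans _)-> //]] := dfX l w.
  by rewrite mulr_ge0// ltW.
have df_le l w : df l.+1 w <= dl * C.
  have [X [/(entry_weight_bounds i j)/andP[_ XC] _ /le_trans->//]] := dfX l w.
  by rewrite ler_pM2l.
have df_le' l w : df l w <= dl * C.
  have [X mX] := minimizer_exists (set_entry (random_matrix Q w) i j (b l)) cD D0.
  have := slope_le cD D0 (ble l) (lexx _) mX; rewrite bD => /le_trans; apply.
  have /andP[_ XC] := entry_weight_bounds i j (Dbox mX.1).
  by rewrite ler_pM2l.
(* The sum telescopes with step two to at most [2 * dl * C], while each [S l] that occurs
   contributes at least [e * dl]. *)
have SC w : \sum_(l < L) (\1_(S l) w : R) <= C * 2 / e.
  rewrite ler_pdivlMr// -(ler_pM2r dl0) -mulrA mulr_suml.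
  apply: (@le_trans _ _ (\sum_(l < L) (df l w - df l.+2 w))).
    apply: ler_sum => l _; rewrite indicE.
    have [wS|wS] := boolP (w \in S l); first by move: wS; rewrite inE mul1r.
    by rewrite mul0r subr_ge0 (le_trans (df_mono _ _)).
  have -> : \sum_(l < L) (df l w - df l.+2 w) = df 0 w + df 1 w - (df L w + df L.+1 w).
    elim: (L) => [|m IH]; first by rewrite big_ord0 subrr.
    by rewrite big_ord_recr /= IH; ring.
  have := df_le' 0 w; have := df_le' 1 w; have := df_ge0 L w; have := df_ge0 L.+1 w.
  by rewrite -/dl; lra.
pose J l : set Omega := Q i j @^-1` `[b l.+1, b l.+1 + N%:R^-1[.
have mJ l : measurable (J l).
  by rewrite /J -[X in measurable X]setTI; exact: (measurable_funPT (Q i j)).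
have PB : (P B <= \sum_(l < L) P (S l `&` J l))%E.
  apply: (@content_subadditive _ _ _ P B (fun l => S l `&` J l)) => //.
    by move=> l _; apply: measurableI.
  move=> w Bw; suff : (\bigcup_(k < L) (S k `&` J k)) w by rewrite bigcup_mkord.
  have /andP[w1 w2] := Br _ Bw.
  have t0 : 0 <= (Q i j w + r) * N%:R by rewrite mulr_ge0// -lerBlDr sub0r.
  have /andP[t1 t2] := truncn_itv t0.
  set l := Num.truncn ((Q i j w + r) * N%:R) in t1 t2.
  have N0' : 0 < N%:R :> R by rewrite ltr0n.
  have bl1 : b l.+1 <= Q i j w.
    rewrite /b -natr1 addrK -lerBrDl opprK.
    by rewrite ler_pdivrMr.
  have bl2 : Q i j w < b l.+2.
    rewrite /b -natr1 addrK -ltrBlDl opprK.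
    by rewrite ltr_pdivlMr.
  exists l => /=.
    rewrite -(ltr_nat R); apply: (le_lt_trans t1).
    by rewrite -ltr_pdivlMr// -ltrBrDr addrC.
  split; last first.
    by rewrite /J /= in_itv /= bl1 -/dl -bS.
  have [X [Y [mX mY XY]]] := BXY _ Bw.
  have QE : random_matrix Q w = set_entry (random_matrix Q w) i j (Q i j w).
    apply/matrixP => k m; rewrite !mxE; case: ifP => // /orP[] /eqP[-> ->] //.
    by have := Qsym w => /matrixP/(_ i j); rewrite !mxE.
  rewrite QE in mX mY.
  (* The larger weight, of [Y], bounds the slope of the left neighbouring cell from below; the
     smaller one, of [X], bounds that of the right neighbour from above. *)
  have := slope_ge cD D0 (ble l) bl1 mY; have := slope_le cD D0 (ble l.+2) (ltW bl2) mX.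
  rewrite !bD -/(F (b l.+3) w) -/(F (b l.+2) w) -/(F (b l.+1) w) -/(F (b l) w) -/(df l.+2 w)
    -/(df l w) /S /=.
  have : dl * (entry_weight i j X + e) <= dl * entry_weight i j Y by rewrite ler_pM2l.
  by rewrite mulrDr (mulrC e); lra.
apply: (le_trans PB).
apply: (@le_trans _ _ (\sum_(l < L) (P (S l) * (c * dl)%:E)))%E.
  apply: lee_sum => l _.
  rewrite (@independent_other _ _ P _ _ _ (i, j) _ Qind (S l) `[b l.+1, b l.+1 + N%:R^-1[) //.
    by apply: lee_wpmul2l => //; exact: Pc.
  by rewrite inE.
rewrite -ge0_sume_distrl; last by move=> l _.
apply: (@le_trans _ _ ((C * 2 / e)%:E * (c * dl)%:E))%E; last by rewrite -EFinM mulrC.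
apply: lee_wpmul2r; first by rewrite lee_fin mulr_ge0// ltW.
exact: sum_probability_le.
Qed.

(** Restrict the entry to the range from -m to m, cut it into 2mN cells and let N grow: the bound of
    [entry_gap_le] is O(1/N) whatever the number of cells. *)
Lemma entry_gap_null (B : set Omega) (e c : R) :
  measurable B -> 0 < e -> 0 <= c ->
  (forall a h : R, 0 <= h -> (P (Q i j @^-1` `[a, (a + h)%R[%classic) <= (c * h)%:E)%E) ->
  (forall w, B w -> exists X Y, [/\ minimizer D (mxdot (random_matrix Q w)) X,
     minimizer D (mxdot (random_matrix Q w)) Y &
     entry_weight i j X + e <= entry_weight i j Y]) ->
  P B = 0%E.
Proof.
move=> mB e0 c0 Pc BXY.
pose Bm (m : nat) := B `&` Q i j @^-1` `[(- m%:R), m%:R[.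
have mBm m : measurable (Bm m).
  apply: measurableI => //.
  by rewrite -[X in measurable X]setTI; exact: (measurable_funPT (Q i j)).
have Bm0 m : P (Bm m) = 0%E.
  have := fin_num_measure P _ (mBm m); have : (0 <= P (Bm m))%E by exact: measure_ge0.
  have : forall N : nat, (0 < N)%N ->
      (P (Bm m) <= (c / N%:R * ((\sum_(k < n) \sum_(l < n) 1) * 2 / e))%:E)%E.
    move=> N N0; have N0' : 0 < N%:R :> R by rewrite ltr0n.
    apply: (@entry_gap_le _ e c m%:R N (2 * m * N)) => //.
    - move=> w [_] /=; rewrite in_itv /= !natrM mulfK ?gt_eqF// mulrDl.
      by move=> /andP[-> h]; rewrite !mul1r addKr.
    - by move=> a; apply: Pc; rewrite invr_ge0.
    - by move=> w [/BXY].
  case: (P (Bm m)) => [x| |] H x0 _ //; last by have := H 1%N isT; rewrite leye_eq.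
  suff -> : x = 0 by [].
  move: x0; rewrite lee_fin => x0; apply/eqP; rewrite eq_le x0 andbT.
  apply/ler_addgt0Pr => t t0; rewrite add0r.
  set C := \sum_(k < n) _ in H.
  have C0 : 0 <= C by apply: sumr_ge0 => k _; apply: sumr_ge0.
  pose N := (Num.truncn (c * (C * 2 / e) / t)).+1.
  have := H N isT; rewrite lee_fin => /le_trans; apply.
  have := truncnS_gt (c * (C * 2 / e) / t); rewrite -/N ltr_pdivrMr// => /ltW hN.
  by rewrite mulrAC ler_pdivrMr ?ltr0n// (le_trans hN)// mulrC.
have -> : B = \bigcup_m Bm m.
  apply/seteqP; split => [w Bw|w [m _ []//]].
  exists (Num.truncn `|Q i j w|).+1 => //; split => //=.
  rewrite in_itv /=.
  have := truncnS_gt `|Q i j w|; rewrite ltr_norml => /andP[/ltW -> ->]//.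
apply/negligibleP; first exact: bigcup_measurable.
by apply: negligible_bigcup => m; apply/negligibleP; [exact: mBm|exact: Bm0].
Qed.

End null.

Lemma normal_prob_le (s : R) (A : set R) : s != 0 -> measurable A ->
  (normal_prob 0 s A <= (normal_peak s)%:E * lebesgue_measure A)%E.
Proof.
move=> s0 mA; rewrite /normal_prob -integral_cst//.
apply: ge0_le_integral => //=.
- by move=> x _; rewrite lee_fin normal_pdf_ge0.
- by apply/measurable_EFinP/measurable_funTS; exact: measurable_normal_pdf.
- by move=> x _; rewrite lee_fin normal_pdf_ub.
Qed.

(** * Measurability of the uniqueness event *)

Section unique_minimizer.
Context d (Omega : measurableType d) (n : nat).
Context (q : 'I_n -> 'I_n -> Omega -> R) (D : set 'M[R]_n).
Hypothesis mq : forall i j, measurable_fun setT (q i j).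
Hypothesis cD : compact D.
Hypothesis D0 : D !=set0.
Hypothesis Dbox : D `<=` @box01 R n.
Hypothesis Dsym : forall X, D X -> X^T = X.

Let Qm w : 'M[R]_n := \matrix_(i, j) q i j w.

(** Some minimizer lies in [E] exactly when the value over the intersection of [D] and [E] does not
    exceed the value over [D], and both values are measurable. *)
Lemma restricted_minimizer_measurable (E : set 'M[R]_n) :
  compact (D `&` E) ->
  measurable [set w | exists2 X, minimizer D (mxdot (Qm w)) X & E X].
Proof.
move=> cDE; have [DE0|DE0] := pselect (D `&` E !=set0); last first.
  rewrite (_ : mkset _ = set0)//; apply/seteqP; split => // w [X [DX _] EX].
  by apply: DE0; exists X.
rewrite (_ : mkset _ = [set w | min_value (D `&` E) (mxdot (Qm w)) <= min_value D (mxdot (Qm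
  w))]).
  apply: measurable_le_set; apply: min_value_measurable => //.
  by move=> X [/Dbox].
apply/seteqP; split => w /=.
  move=> [X mX EX]; rewrite (minimizer_min_value mX).
  have [Y mY] := minimizer_exists (Qm w) cDE DE0.
  by rewrite (minimizer_min_value mY); apply: mY.2; split => //; exact: mX.1.
have [Y mY] := minimizer_exists (Qm w) cDE DE0.
have [X mX] := minimizer_exists (Qm w) cD D0.
rewrite (minimizer_min_value mY) (minimizer_min_value mX) => YX.
exists Y; last exact: mY.1.2.
by split=> [|Z DZ]; [exact: mY.1.1|exact: le_trans YX (mX.2 _ DZ)].
Qed.

(** Two minimizers separated at one entry by rationals: countably many such events make up the
    failure of uniqueness. *)
Definition gap_event (t : 'I_n * 'I_n * (rat * rat)) : set Omega :=
  let: (i, j, (s, r)) := t in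
  if (i <= j)%N && (s < r) then
    [set w | exists2 X, minimizer D (mxdot (Qm w)) X & [set X | X i j <= ratr s] X] `&`
    [set w | exists2 X, minimizer D (mxdot (Qm w)) X & [set X | ratr r <= X i j] X]
  else set0.

Lemma gap_event_measurable t : measurable (gap_event t).
Proof.
case: t => [[i j] [s r]] /=; case: ifP => // _.
by apply: measurableI; apply: restricted_minimizer_measurable;
  [exact: coord_le_compact|exact: coord_ge_compact].
Qed.

Lemma not_unique_gap :
  ~` [set w | exists X, unique (minimizer D (mxdot (Qm w))) X] = \bigcup_t gap_event t.
Proof.
apply/seteqP; split => w /=; last first.
  move=> [[[i j] [s r]] _ /=]; case: ifP => // /andP[_ sr] [[X mX Xs] [Y mY Yr]] [Z [mZ ZU]].
  move: Xs Yr; rewrite -(ZU _ mX) -(ZU _ mY) /= => Zs /le_trans /(_ Zs).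
  by rewrite ler_rat leNgt sr.
move=> nU; have [X mX] := minimizer_exists (Qm w) cD D0.
have [Y mY YX] : exists2 Y, minimizer D (mxdot (Qm w)) Y & Y <> X.
  apply: contrapT => nY; apply: nU; exists X; split => // Y mY.
  by apply: contrapT => XY; apply: nY; exists Y => // /esym.
have [i [j [ij XYij]]] : exists i j : 'I_n, (i <= j)%N /\ X i j != Y i j.
  apply: contrapT => nij; apply: YX; apply/matrixP => i j.
  wlog ij : i j / (i <= j)%N.
    move=> H; have [/H//|/ltnW/H] := leqP i j.
    by move=> YX; rewrite -(Dsym mX.1) -(Dsym mY.1) !mxE.
  by apply: contrapT => /eqP XY; apply: nij; exists i, j; rewrite eq_sym.
wlog XY : X Y mX mY YX XYij / X i j < Y i j.
  move=> H; have [XY|XY|XY] := ltgtP (X i j) (Y i j); last by rewrite XY eqxx in XYij.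
    exact: H mX mY YX XYij XY.
  by apply: H mY mX _ _ XY; [move/esym|rewrite eq_sym].
have [r] := rat_in_itvoo XY; rewrite in_itv /= => /andP[Xr rY].
have [s] := rat_in_itvoo Xr; rewrite in_itv /= => /andP[Xs sr].
exists (i, j, (s, r)) => //=; rewrite ij /=.
have -> : s < r by move: sr; rewrite ltr_rat.
by split; [exists X => //; exact: ltW|exists Y => //; exact: ltW].
Qed.

Lemma unique_minimizer_measurable :
  measurable [set w | exists X, unique (minimizer D (mxdot (Qm w))) X].
Proof.
rewrite -[X in measurable X]setCK not_unique_gap; apply: measurableC.
by apply: countable_bigcupT_measurable => // t; exact: gap_event_measurable.
Qed.

End unique_minimizer.

Lemma unique_minimizer_as d (Omega : measurableType d) (P : probability Omega R)
    (n : nat) (Q : 'I_n -> 'I_n -> {RV P >-> R}) (D : set 'M[R]_n) :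
  is_GOE Q -> compact D -> D !=set0 -> D `<=` @box01 R n ->
  (forall X, D X -> X^T = X) ->
  P (~` [set w | exists X, unique (minimizer D (mxdot (random_matrix Q w))) X]) = 0%E.
Proof.
move=> [Qsym Qdiag Qoff Qind] cD D0 Dbox Dsym.
have mQ i j : measurable_fun setT (Q i j) by exact: measurable_funPT.
pose q i j : Omega -> R := Q i j.
rewrite (@not_unique_gap _ _ _ q)//.
apply/negligibleP.
  by apply: countable_bigcupT_measurable => // t; exact: gap_event_measurable.
have [f] : exists f : nat -> option ('I_n * 'I_n * (rat * rat)), forall t, exists k, f k =
  Some t.
  by exists unpickle => t; exists (pickle t); rewrite pickleK.
move=> fsurj.
rewrite (_ : \bigcup_t _ = \bigcup_k (if f k is Some t then gap_event q D t else set0)); last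
  first.
  apply/seteqP; split => w [t _]; first by have [k fk] := fsurj t; exists k => //; rewrite fk.
  by case: (f t) => [u|//]; exists u.
apply: negligible_bigcup => k; case: (f k) => [t|]; last exact: negligible_set0.
apply/negligibleP; first exact: gap_event_measurable.
case: t => [[i j] [s r]]; have := @gap_event_measurable _ _ _ q D mQ cD D0 Dbox (i, j, (s, r)).
move=> /=; case: ifP => // /andP[ij sr] mG.
have [v [v0 Qv]] : exists v : R, v != 0 /\ forall A : set R, measurable A ->
    distribution P (Q i j) A = normal_prob 0 v A.
  move: ij; rewrite leq_eqVlt => /predU1P[/val_inj <-|ij].
    exists (Num.sqrt 1); split; last exact: Qdiag.
    by rewrite sqrtr1 oner_eq0.
  exists (Num.sqrt 2^-1); split; last exact: Qoff.
  by rewrite gt_eqF// sqrtr_gt0 invr_gt0.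
apply: (@entry_gap_null _ _ P n Q i j D ij Qsym Qind cD D0 Dbox _ (ratr r - ratr s)
  (normal_peak v)) => //.
- by rewrite subr_gt0 ltr_rat.
- exact: normal_peak_ge0.
- move=> a h h0; rewrite -[leLHS]/(distribution P (Q i j) _) Qv//.
  apply: (le_trans (normal_prob_le v0 _)) => //.
  rewrite lebesgue_measure_itv /= lte_fin; case: ifP => _; last first.
    by rewrite mule0 lee_fin mulr_ge0// normal_peak_ge0.
  by rewrite -EFinD -EFinM lee_fin addrAC subrr add0r.
(* Off the diagonal the weight is twice the entry, which only widens the gap. *)
- move=> w [[X mX Xs] [Y mY Yr]]; exists X, Y; split => //.
  rewrite !entry_weight_sym ?Dsym//; [|exact: mY.1|exact: mX.1].
  have sr' : ratr s < ratr r :> R by rewrite ltr_rat.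
  move: Xs Yr; rewrite /=; case: eqVneq => _ /=; lra.
Qed.

End uniqueness.

(** * The two programs as linear minimization *)

Section programs.
Context {R : realType}.

Lemma mxdotDr n (Q A B : 'M[R]_n) : mxdot Q (A + B) = mxdot Q A + mxdot Q B.
Proof. by rewrite /mxdot mulmxDr mxtraceD. Qed.

Lemma mxdotZr n (Q A : 'M[R]_n) a : mxdot Q (a *: A) = a * mxdot Q A.
Proof. by rewrite /mxdot -scalemxAr mxtraceZ. Qed.

Lemma mxdot1E n (X : 'M[R]_n) : mxdot (const_mx 1) X = \sum_i \sum_j X i j.
Proof.
by rewrite mxdotE; apply: eq_bigr => i _; apply: eq_bigr => j _; rewrite mxE mul1r.
Qed.

Lemma outerE n (x : 'cV[R]_n) i j : (x *m x^T) i j = x i 0 * x j 0.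
Proof. by rewrite mxE big_ord1 !mxE. Qed.

Lemma mxdot_outer n (Q : 'M[R]_n) (x : 'cV[R]_n) : mxdot Q (x *m x^T) = quad_form Q x.
Proof.
rewrite mxdotE quad_formE; apply: eq_bigr => i _; apply: eq_bigr => j _.
by rewrite outerE mulrA (mulrC (Q i j)).
Qed.

Lemma mxdot1_outer n (x : 'cV[R]_n) :
  mxdot (const_mx 1) (x *m x^T) = (\sum_i x i 0) ^+ 2.
Proof.
rewrite mxdot1E expr2 mulr_suml; apply: eq_bigr => i _; rewrite mulr_sumr.
by apply: eq_bigr => j _; rewrite outerE.
Qed.

Lemma outer_psd n (x : 'cV[R]_n) : psdmx (x *m x^T).
Proof.
split; first by rewrite trmx_mul trmxK.
move=> v; rewrite /quad_form !mulmxA -mulmxA mxE big_ord1.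
have -> : (v^T *m x) 0 ord0 = (x^T *m v) ord0 0.
  by rewrite -(trmxK (v^T *m x)) trmx_mul trmxK mxE.
by rewrite -expr2 sqr_ge0.
Qed.

Lemma outer_feasible n (x : 'cV[R]_n) : simplex x -> dnn_feasible (x *m x^T).
Proof.
move=> [x0 x1]; split; first by rewrite mxdot1_outer x1 expr1n.
  exact: outer_psd.
by move=> i j; rewrite outerE mulr_ge0.
Qed.

Lemma dnn_feasible_box n : @dnn_feasible R n `<=` @box01 R n.
Proof.
move=> X [X1 _ X0] i j; rewrite X0 /= -X1 mxdot1E (bigD1 i)//= (bigD1 j)//=.
rewrite -addrA lerDl addr_ge0// ?sumr_ge0// => k _.
by rewrite sumr_ge0.
Qed.

Lemma closed_le_continuous (T : topologicalType) (f g : T -> R) :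
  continuous f -> continuous g -> closed [set X | f X <= g X].
Proof.
move=> cf cg; rewrite (_ : mkset _ = (fun X => g X - f X) @^-1` [set x | 0 <= x]).
  apply: preimage_closed; last exact: closed_ge.
  by move=> X _; apply: continuousB; [exact: cg|exact: cf].
by apply/seteqP; split => X /=; rewrite subr_ge0.
Qed.

Lemma closed_eq_continuous (T : topologicalType) (f g : T -> R) :
  continuous f -> continuous g -> closed [set X | f X = g X].
Proof.
move=> cf cg; rewrite (_ : mkset _ = [set X | f X <= g X] `&` [set X | g X <= f X]).
  by apply: closedI; exact: closed_le_continuous.
apply/seteqP; split => X /= => [->|[fg gf]]; first by rewrite lexx.
by apply/eqP; rewrite eq_le fg gf.
Qed.

Lemma dnn_feasible_compact n : compact (@dnn_feasible R n).
Proof.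
have cq (v : 'cV[R]_n) : continuous (fun X => quad_form X v).
  under [fun X => _]eq_fun do rewrite quad_formE.
  apply: sum_continuous => i; apply: sum_continuous => j x.
  apply: (@continuousM R _ (fun X : 'M[R]_n => v i 0 * X i j) (fun=> v j 0)); last exact:
    cst_continuous.
  by apply: continuousM; [exact: cst_continuous|exact: coord_continuous].
apply: (@subclosed_compact _ _ (@box01 R n)).
- rewrite (_ : @dnn_feasible R n =
      ([set X | mxdot (const_mx 1) X = 1] `&`
       (\bigcap_ij [set X : 'M[R]_n | X ij.1 ij.2 = X ij.2 ij.1])) `&`
      ((\bigcap_v [set X | 0 <= quad_form X v]) `&`
       (\bigcap_ij [set X : 'M[R]_n | 0 <= X ij.1 ij.2]))).
    apply: closedI; apply: closedI.
    + by apply: closed_eq_continuous; [exact: mxdot_continuous|exact: cst_continuous].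
    + by apply: closed_bigI => ij _; apply: closed_eq_continuous; exact: coord_continuous.
    + by apply: closed_bigI => v _; apply: closed_le_continuous; [exact:
      cst_continuous|exact: cq].
    + by apply: closed_bigI => ij _; apply: closed_le_continuous;
        [exact: cst_continuous|exact: coord_continuous].
  apply/seteqP; split => X.
    move=> [X1 [XT Xv] X0]; split; split.
    + exact: X1.
    + by move=> [i j] _ /=; rewrite -{2}XT mxE.
    + by move=> v _; exact: Xv.
    + by move=> [i j] _; exact: X0.
  move=> [[X1 X3] [X4 X5]]; split.
  + exact: X1.
  + split; last by move=> v; exact: (X4 v I).
    by apply/matrixP => i j; rewrite mxE (X3 (j, i) I).
  + by move=> i j; exact: (X5 (i, j) I).
- exact: mx_box_compact.
- exact: dnn_feasible_box.
Qed.

Definition row_sums n (X : 'M[R]_n) : 'cV[R]_n := \col_i \sum_k X i k.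

(** These are the x x^T with x in the simplex. As x is then the vector of row sums, membership is a
    system of polynomial equations, so the set is closed; on it the standard quadratic program
    becomes linear. *)
Definition dnn_rank_one n : set 'M[R]_n :=
  @dnn_feasible R n `&` [set X : 'M[R]_n | forall i j, X i j = row_sums X i 0 * row_sums X j 0].

Lemma dnn_rank_oneE n (X : 'M[R]_n) :
  dnn_rank_one X <-> exists2 x, simplex x & X = x *m x^T.
Proof.
split=> [[[X1 Xp X0] XE]|[x sx ->]].
  exists (row_sums X); last by apply/matrixP => i j; rewrite outerE XE.
  split; first by move=> i; rewrite mxE sumr_ge0.
  by rewrite -X1 mxdot1E; apply: eq_bigr => i _; rewrite mxE.
split; first exact: outer_feasible.
have rE i : row_sums (x *m x^T) i 0 = x i 0.
  by rewrite mxE; under eq_bigr do rewrite outerE; rewrite -mulr_sumr sx.2 mulr1.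
by move=> i j; rewrite !rE outerE.
Qed.

Lemma outer_inj n (x y : 'cV[R]_n) : simplex x -> simplex y ->
  x *m x^T = y *m y^T -> x = y.
Proof.
move=> sx sy xy; apply/matrixP => i j; rewrite ord1.
have rE (z : 'cV[R]_n) : simplex z -> z i 0 = \sum_j (z *m z^T) i j.
  by move=> sz; under eq_bigr do rewrite outerE; rewrite -mulr_sumr sz.2 mulr1.
by rewrite (rE x sx) (rE y sy) xy.
Qed.

Lemma dnn_rank_one_compact n : compact (@dnn_rank_one n).
Proof.
have rc (i : 'I_n) : continuous (fun X : 'M[R]_n => row_sums X i 0).
  under [fun X => _]eq_fun do rewrite mxE.
  by apply: sum_continuous => k; exact: coord_continuous.
apply: compact_closedI; first exact: dnn_feasible_compact.
rewrite (_ : mkset _ = \bigcap_ij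
  [set X : 'M[R]_n | X ij.1 ij.2 = row_sums X ij.1 0 * row_sums X ij.2 0]).
  apply: closed_bigI => ij _; apply: closed_eq_continuous; first exact: coord_continuous.
  move=> X; apply: (@continuousM R _ (fun X : 'M[R]_n => row_sums X ij.1 0)
    (fun X : 'M[R]_n => row_sums X ij.2 0)); exact: rc.
by apply/seteqP; split => X XE; [move=> [i j] _; exact: XE|move=> i j; exact: (XE (i, j) I)].
Qed.

Lemma dnn_rank_one_neq0 n : (0 < n)%N -> @dnn_rank_one n !=set0.
Proof.
case: n => // n _; pose x : 'cV[R]_n.+1 := delta_mx 0 0.
exists (x *m x^T); apply/dnn_rank_oneE; exists x => //; split.
  by move=> i; rewrite mxE ler0n.
rewrite (bigD1 0)//= mxE eqxx big1 ?addr0// => i i0.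
by rewrite mxE (negbTE i0).
Qed.

Lemma stqp_valueE n (Q : 'M[R]_n) : stqp_value Q = min_value (@dnn_rank_one n) (mxdot Q).
Proof.
rewrite /stqp_value /min_value; congr inf; apply/seteqP; split => _ [x Hx <-].
  exists (x *m x^T); last exact: mxdot_outer.
  by apply/dnn_rank_oneE; exists x.
by move/dnn_rank_oneE : Hx => [y sy ->]; exists y => //; rewrite mxdot_outer.
Qed.

Lemma stqp_optimizerE n (Q : 'M[R]_n) x : simplex x ->
  stqp_optimizer Q x <-> minimizer (@dnn_rank_one n) (mxdot Q) (x *m x^T).
Proof.
move=> sx; split=> [[_ xm]|[_ xm]]; split => //.
- by apply/dnn_rank_oneE; exists x.
- by move=> _ /dnn_rank_oneE[y sy ->]; rewrite !mxdot_outer; exact: xm.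
- move=> y sy; rewrite -!mxdot_outer; apply: xm.
  by apply/dnn_rank_oneE; exists y.
Qed.

Lemma stqp_uniqueE n (Q : 'M[R]_n) :
  stqp_unique Q <-> exists X, unique (minimizer (@dnn_rank_one n) (mxdot Q)) X.
Proof.
split=> [[x [xm xU]]|[X [Xm XU]]].
  exists (x *m x^T); split; first exact/stqp_optimizerE/xm/xm.1.
  move=> Y mY; have /dnn_rank_oneE[y sy Yy] := mY.1.
  by rewrite Yy (xU y)//; apply/stqp_optimizerE => //; rewrite -Yy.
have /dnn_rank_oneE[x sx Xx] := Xm.1.
exists x; split; first by apply/stqp_optimizerE => //; rewrite -Xx.
move=> y ym; apply: outer_inj => //; first exact: ym.1.
by rewrite -Xx; apply: XU; apply/stqp_optimizerE => //; exact: ym.1.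
Qed.

Lemma rank_outer n (x : 'cV[R]_n) : simplex x -> \rank (x *m x^T) = 1%N.
Proof.
move=> sx; apply/eqP; rewrite eqn_leq mulmx_max_rank lt0n mxrank_eq0.
apply/eqP => x0; have [X1 _ _] := outer_feasible sx; move: X1.
rewrite x0 mxdot1E big1 => [/eqP|i _]; first by rewrite eq_sym oner_eq0.
by rewrite big1// => j _; rewrite mxE.
Qed.

(** Write X = u v with a column u and a row v. By symmetry the i-th row sum is both u_i times the
    sum of v and v_i times the sum of u, so products of row sums are X_ij times the total mass 1. *)
Lemma rank_one_dnn n (X : 'M[R]_n) : dnn_feasible X -> \rank X = 1%N -> dnn_rank_one X.
Proof.
move=> fX rX; split => //; have [X1 [XT _] _] := fX.
have [u [v XE]] : exists (u : 'cV[R]_n) (v : 'rV[R]_n), X = u *m v.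
  have := mulmx_base X; move: (col_base X) (row_base X); rewrite rX => u v XE.
  by exists u, v.
have XuvE i j : X i j = u i 0 * v 0 j by rewrite XE mxE big_ord1.
have r1 i : row_sums X i 0 = u i 0 * \sum_k v 0 k.
  by rewrite mxE mulr_sumr; apply: eq_bigr => k _; rewrite XuvE.
have r2 i : row_sums X i 0 = v 0 i * \sum_k u k 0.
  rewrite mxE mulr_sumr; apply: eq_bigr => k _.
  by rewrite -XT mxE XuvE mulrC.
move=> i j; rewrite /= r1 r2 mulrACA -XuvE.
suff -> : (\sum_k v 0 k) * (\sum_k u k 0) = 1 by rewrite mulr1.
rewrite -X1 mxdot1E mulrC mulr_suml; apply: eq_bigr => k _.
by rewrite mulr_sumr; apply: eq_bigr => l _; rewrite XuvE.
Qed.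

(** A rank-one optimizer lies in [dnn_rank_one], so the two values agree. If they agree, a minimizer
    over [dnn_rank_one] is optimal for the relaxation, and uniqueness identifies it with the
    optimizer. *)
Lemma dnn_unique_rank_oneE n (Q : 'M[R]_n) : (0 < n)%N ->
  dnn_unique_rank_one Q <->
  (exists X, unique (dnn_optimizer Q) X) /\ dnn_exact Q.
Proof.
move=> n0; have [Y mY] := minimizer_exists Q (@dnn_rank_one_compact n) (dnn_rank_one_neq0 n0).
split=> [[X [mX XU] rX]|[[X [mX XU]] ex]].
  split; first by exists X.
  rewrite /dnn_exact stqp_valueE (minimizer_min_value mY) /dnn_value (minimizer_min_value mX).
  apply/eqP; rewrite eq_le (mX.2 _ mY.1.1) /=; apply: mY.2.
  exact: rank_one_dnn mX.1 rX.
exists X => //; suff -> : X = Y.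
  by have /dnn_rank_oneE[x sx ->] := mY.1; exact: rank_outer.
apply: XU; split; first exact: mY.1.1.
move: ex; rewrite /dnn_exact stqp_valueE (minimizer_min_value mY) /dnn_value
  (minimizer_min_value mX) => <-.
exact: mX.2.
Qed.

(** Under exactness every minimizer over [dnn_rank_one] is an optimizer of the relaxation, so
    uniqueness passes down. *)
Lemma dnn_unique_exact_stqp n (Q : 'M[R]_n) : (0 < n)%N ->
  (exists X, unique (dnn_optimizer Q) X) -> dnn_exact Q -> stqp_unique Q.
Proof.
move=> n0 [X [mX XU]] ex; apply/stqp_uniqueE.
have dnn Y : minimizer (@dnn_rank_one n) (mxdot Q) Y -> dnn_optimizer Q Y.
  move=> mY; split; first exact: mY.1.1.
  move: ex; rewrite /dnn_exact stqp_valueE (minimizer_min_value mY) /dnn_value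
    (minimizer_min_value mX) => <-.
  exact: mX.2.
have [Y mY] := minimizer_exists Q (@dnn_rank_one_compact n) (dnn_rank_one_neq0 n0).
exists Y; split => // Z mZ; rewrite -(XU _ (dnn _ mY)); exact: XU (dnn _ mZ).
Qed.

End programs.

(** * Exactness when the components are small *)

Section exactness.
Context {R : realType}.

Definition bilin n (X : 'M[R]_n) (u v : 'cV[R]_n) : R := (u^T *m X *m v) 0 0.

Lemma bilin_sym n (X : 'M[R]_n) u v : X^T = X -> bilin X u v = bilin X v u.
Proof.
move=> XT; rewrite /bilin -[u^T *m X *m v]trmxK mxE !trmx_mul trmxK XT.
by rewrite mulmxA.
Qed.

Lemma bilinDl n (X : 'M[R]_n) (u v w : 'cV[R]_n) :
  bilin X (u + v) w = bilin X u w + bilin X v w.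
Proof. by rewrite /bilin linearD !mulmxDl mxE. Qed.

Lemma bilinZl n (X : 'M[R]_n) (u v : 'cV[R]_n) a :
  bilin X (a *: u) v = a * bilin X u v.
Proof. by rewrite /bilin linearZ -!scalemxAl mxE. Qed.

Lemma bilinDr n (X : 'M[R]_n) (u v w : 'cV[R]_n) :
  bilin X u (v + w) = bilin X u v + bilin X u w.
Proof. by rewrite /bilin mulmxDr mxE. Qed.

Lemma bilinZr n (X : 'M[R]_n) (u v : 'cV[R]_n) a :
  bilin X u (a *: v) = a * bilin X u v.
Proof. by rewrite /bilin -scalemxAr mxE. Qed.

Lemma quad_form_bilin n (X : 'M[R]_n) v : quad_form X v = bilin X v v.
Proof. by []. Qed.

Lemma quad_form_comb n (X : 'M[R]_n) (u v : 'cV[R]_n) a b : X^T = X ->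
  quad_form X (a *: u + b *: v) =
  a ^+ 2 * quad_form X u + 2 * a * b * bilin X u v + b ^+ 2 * quad_form X v.
Proof.
move=> XT; rewrite !quad_form_bilin !bilinDl !bilinDr !bilinZl !bilinZr.
by rewrite (bilin_sym v u XT); ring.
Qed.

Lemma psd_cauchy_schwarz n (X : 'M[R]_n) u v : psdmx X ->
  bilin X u v ^+ 2 <= quad_form X u * quad_form X v.
Proof.
move=> [XT Xp]; set a := quad_form X u; set b := bilin X u v; set c := quad_form X v.
have a0 : 0 <= a by exact: Xp.
have c0 : 0 <= c by exact: Xp.
(* If ac < b^2, the first two test vectors force c = 0 and a = 0; the third then refutes this
   degenerate case. *)
have H1 := Xp (c *: u + (- b) *: v); rewrite quad_form_comb// -/a -/b -/c in H1.
have H2 := Xp (b *: u + (- a) *: v); rewrite quad_form_comb// -/a -/b -/c in H2.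
have H3 := Xp (1 *: u + (- b) *: v); rewrite quad_form_comb// -/a -/b -/c in H3.
rewrite leNgt; apply/negP => H.
move: (a) (b) (c) a0 c0 H1 H2 H3 H => {}a {}b {}c a0 c0 H1 H2 H3 H.
clear Xp XT.
have c1 : c = 0 by apply/eqP; rewrite eq_le c0 andbT leNgt; apply/negP => ?; nra.
have a1 : a = 0 by apply/eqP; rewrite eq_le a0 andbT leNgt; apply/negP => ?; nra.
by rewrite c1 a1 in H H3; nra.
Qed.

Lemma bilin_delta n (X : 'M[R]_n) i v : bilin X (delta_mx i 0) v = (X *m v) i 0.
Proof. by rewrite /bilin trmx_delta -mulmxA -rowE mxE. Qed.

Lemma quad_form_delta n (X : 'M[R]_n) i : quad_form X (delta_mx i 0) = X i i.
Proof. by rewrite quad_form_bilin bilin_delta -colE mxE. Qed.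

Lemma psd_entry_sqr n (X : 'M[R]_n) i j : psdmx X -> X i j ^+ 2 <= X i i * X j j.
Proof.
move=> Xp; have := psd_cauchy_schwarz (delta_mx i 0) (delta_mx j 0) Xp.
by rewrite bilin_delta -colE mxE !quad_form_delta.
Qed.

(* Subtracting a small multiple of [x x^T], with [x] in the range of [X],
   preserves positive semidefiniteness by Cauchy-Schwarz. *)
Lemma psd_sub_outer n (X : 'M[R]_n) v e : psdmx X -> 0 <= e ->
  e * quad_form X v <= 1 -> psdmx (X - e *: (X *m v *m (X *m v)^T)).
Proof.
move=> Xp e0 ev; have [XT X0] := Xp; split.
  by rewrite linearB linearZ /= trmx_mul trmxK XT.
move=> u; have -> : quad_form (X - e *: (X *m v *m (X *m v)^T)) u =
    quad_form X u - e * bilin X u v ^+ 2.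
  rewrite /quad_form mulmxBr mulmxBl -scalemxAr -scalemxAl !mxE; congr (_ - e * _).
  have -> : \sum_j (u^T *m (X *m v *m (X *m v)^T)) 0 j * u j 0 =
      (u^T *m (X *m v *m (X *m v)^T) *m u) 0 0 by rewrite mxE.
  rewrite !mulmxA -(mulmxA (u^T *m X *m v)) mxE big_ord1 expr2 -/(bilin X u v).
  congr (_ * _); rewrite (bilin_sym _ _ XT) /bilin trmx_mul XT.
  by [].
rewrite subr_ge0.
have CS := psd_cauchy_schwarz u v Xp.
apply: (@le_trans _ _ (e * (quad_form X u * quad_form X v))); first exact: ler_wpM2l.
by rewrite mulrCA ler_piMr.
Qed.

(** * Vectors in the range supported on a clique of positive entries *)

Section clique.
Context {n : nat} (X : 'M[R]_n) (r : 'I_n -> 'I_n).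
Hypothesis Xp : psdmx X.
Hypothesis X0 : forall i j, 0 <= X i j.
Hypothesis Xr : forall i j, 0 < X i j -> r i = r j.
Hypothesis r4 : forall i, (#|[pred j | r j == r i]| <= 4)%N.

Let Xsym i j : X i j = X j i.
Proof. by have [XT _] := Xp; rewrite -{1}XT mxE. Qed.

Let diag_gt0 i j : 0 < X i j -> 0 < X i i.
Proof.
move=> Xij; have := psd_entry_sqr i j Xp; have := X0 i i; have := X0 j j.
by rewrite le_eqVlt => _; rewrite le_eqVlt => /predU1P[<-|//]; rewrite mul0r; nra.
Qed.

Let notpos i j : ~ (0 < X i j) -> X i j = 0.
Proof. by move=> /negP; rewrite -leNgt => Xij; apply/eqP; rewrite eq_le Xij X0. Qed.

(** The last condition lets a small multiple of x x^T stay entrywise below [X]. *)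
Definition clique_vector (x : 'cV[R]_n) : Prop :=
  [/\ forall i, 0 <= x i 0, exists i, 0 < x i 0 &
      forall i j, 0 < x i 0 -> 0 < x j 0 -> 0 < X i j].

(* [v] is chosen with support {i, l, k} so that the coordinates [l] and [k] of [X v]
   vanish; up to a factor, [X v] is a column of the Schur complement of the block
   {l, k}. *)
Lemma four_cycle_vector i l j k : i != l -> i != j -> i != k -> l != j -> l != k -> j != k ->
  0 < X i j -> 0 < X i k -> 0 < X l j -> 0 < X l k -> X i l = 0 -> X j k = 0 ->
  (forall m, m != i -> m != j -> m != k -> m != l -> [/\ X m i = 0, X m l = 0 & X m k = 0]) ->
  exists v, clique_vector (X *m v).
Proof.
move=> il ij ik lj lk jk Xij Xik Xlj Xlk Xil Xjk out.
pose D := X l l * X k k - X l k ^+ 2.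
have D0 : 0 <= D by rewrite subr_ge0 psd_entry_sqr.
pose v : 'cV[R]_n := D *: delta_mx i 0 + ((X l k * X i k) *: delta_mx l 0 +
  (- (X l l * X i k)) *: delta_mx k 0).
have xE m : (X *m v) m 0 = D * X m i + (X l k * X i k * X m l - X l l * X i k * X m k).
  by rewrite /v !mulmxDr -!scalemxAr -!colE !mxE mulNr.
have xl : (X *m v) l 0 = 0 by rewrite xE (Xsym l i) Xil; ring.
have xk : (X *m v) k 0 = 0 by rewrite xE (Xsym k i) (Xsym k l) /D; ring.
have xi0 : 0 <= (X *m v) i 0.
  rewrite leNgt; apply/negP => xi.
  have Xii := diag_gt0 Xij.
  set a := (X *m v) i 0 in xi.
  have vv : quad_form X v = D * a.
    by rewrite quad_form_bilin {1}/v !bilinDl !bilinZl !bilin_delta xl xk -/a; ring.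
  have := Xp.2 ((- a / X i i) *: delta_mx i 0 + 1 *: v).
  rewrite quad_form_comb ?Xp.1// bilin_delta -/a quad_form_delta vv.
  have -> : (- a / X i i) ^+ 2 * X i i = a ^+ 2 / X i i by field; rewrite gt_eqF.
  have -> : 2 * (- a / X i i) * 1 * a = - 2 * (a ^+ 2 / X i i) by field; rewrite gt_eqF.
  have : 0 < a ^+ 2 / X i i by rewrite divr_gt0// -sqrrN exprn_gt0// oppr_gt0.
  by move: (a ^+ 2 / X i i) => z; nra.
have xj : 0 < (X *m v) j 0.
  rewrite xE Xjk mulr0 subr0 (Xsym j i) (Xsym j l) ltr_wpDl// ?mulr_gt0//.
  by rewrite mulr_ge0// ltW.
have xm m : m != i -> m != j -> (X *m v) m 0 = 0.
  move=> mi mj; have [->//|mk] := eqVneq m k; have [->//|ml] := eqVneq m l.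
  by have [e1 e2 e3] := out _ mi mj mk ml; rewrite xE e1 e2 e3; ring.
exists v; split.
- move=> m; have [->//|mi] := eqVneq m i; have [->|mj] := eqVneq m j; first exact: ltW.
  by rewrite xm.
- by exists j.
- have sup m : 0 < (X *m v) m 0 -> m = i \/ m = j.
    have [->|mi] := eqVneq m i; first by left.
    by have [->|mj] := eqVneq m j; [right|rewrite xm// ltxx].
  move=> a b /sup[->|->] /sup[->|->] //; first exact: diag_gt0 Xij.
    by rewrite Xsym.
  by apply: (diag_gt0 (j := i)); rewrite Xsym.
Qed.

Lemma class_card_le (s : seq 'I_n) i : uniq s -> all (fun j => r j == r i) s -> (size s <= 4)%N.
Proof.
move=> us /allP rs; apply: leq_trans (r4 i).
rewrite -(card_uniqP us); apply: subset_leq_card; apply/fintype.subsetP => j /rs.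
by rewrite inE.
Qed.

(** If the neighbours of a vertex in the graph of positive entries are pairwise adjacent, the column
    of that vertex works. Otherwise every vertex with positive diagonal has two nonadjacent
    neighbours, and in a class of at most four vertices only the 4-cycle i, j, l, k remains. *)
Lemma clique_vector_exists i : 0 < X i i -> exists v, clique_vector (X *m v).
Proof.
move=> Xii; apply: contrapT => nv.
have nsimp a : 0 < X a a -> exists j k, [/\ 0 < X a j, 0 < X a k & X j k = 0].
  move=> Xaa; apply: contrapT => H; apply: nv; exists (delta_mx a 0); split.
  - by move=> m; rewrite -colE mxE.
  - by exists a; rewrite -colE mxE.
  - move=> j k; rewrite -colE !mxE => Xja Xka; apply: contrapT => /notpos Xjk.
    by apply: H; exists j, k; rewrite !(Xsym a).
have pos_neq a b c : 0 < X a b -> X a c = 0 -> b != c.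
  by move=> Xab Xac; apply/eqP => bc; move: Xab; rewrite bc Xac ltxx.
have [j [k [Xij Xik Xjk]]] := nsimp _ Xii.
have Xjj : 0 < X j j by apply: (diag_gt0 (j := i)); rewrite Xsym.
have Xkk : 0 < X k k by apply: (diag_gt0 (j := i)); rewrite Xsym.
have Xkj : X k j = 0 by rewrite Xsym.
have jk : j != k by exact: pos_neq Xjj Xjk.
have ij : i != j by apply/eqP => e; move: Xik; rewrite e Xjk ltxx.
have ik : i != k by apply/eqP => e; move: Xij; rewrite e Xkj ltxx.
have rj : r j = r i by rewrite (Xr Xij).
have rk : r k = r i by rewrite (Xr Xik).
(* [j] too has nonadjacent neighbours [l] and [m]. If one of them is [i], the other is as wanted; if
   neither is, then i, j, k, l, m are five vertices in one class. *)
have [l [li lj Xjl Xil]] : exists l, [/\ l != i, l != j, 0 < X j l & X i l = 0].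
  have [l [m [Xjl Xjm Xlm]]] := nsimp _ Xjj.
  have lj : l != j by apply/eqP => e; move: Xjm; rewrite -e Xlm ltxx.
  have mj : m != j by apply/eqP => e; move: Xjl; rewrite -e Xsym Xlm ltxx.
  have lk : l != k by exact: pos_neq Xjl Xjk.
  have mk : m != k by exact: pos_neq Xjm Xjk.
  have Xll : 0 < X l l by apply: (diag_gt0 (j := j)); rewrite Xsym.
  have lm : l != m by exact: pos_neq Xll Xlm.
  have [li|li] := eqVneq l i; first by exists m; split=> //; [rewrite -li eq_sym|rewrite -li].
  have [mi|mi] := eqVneq m i; first by exists l; split=> //; rewrite -mi Xsym.
  have := @class_card_le [:: i; j; k; l; m] i.
  rewrite /= !inE !negb_or ij ik (eq_sym i l) li (eq_sym i m) mi jk (eq_sym j l) lj (eq_sym j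
    m) mj.
  rewrite (eq_sym k l) lk (eq_sym k m) mk lm -(Xr Xjl) -(Xr Xjm) rj rk !eqxx.
  by move=> /(_ isT isT).
have lk : l != k by exact: pos_neq Xjl Xjk.
have rl : r l = r i by rewrite -(Xr Xjl).
have cls m : r m = r i -> m != i -> m != j -> m != k -> m = l.
  move=> rm mi mj mk; apply/eqP/negPn/negP => ml.
  have := @class_card_le [:: i; j; k; l; m] i.
  rewrite /= !inE !negb_or ij ik (eq_sym i l) li (eq_sym i m) mi jk (eq_sym j l) lj (eq_sym j
    m) mj.
  rewrite (eq_sym k l) lk (eq_sym k m) mk (eq_sym l m) ml rm rl rj rk !eqxx.
  by move=> /(_ isT isT).
(* The two nonadjacent neighbours of [k] can only be [i] and [l]. *)
have Xkl : 0 < X k l.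
  have [p [q [Xkp Xkq Xpq]]] := nsimp _ Xkk.
  have pk : p != k by apply/eqP => e; move: Xkq; rewrite -e Xpq ltxx.
  have qk : q != k by apply/eqP => e; move: Xkp; rewrite -e Xsym Xpq ltxx.
  have pj : p != j by exact: pos_neq Xkp Xkj.
  have qj : q != j by exact: pos_neq Xkq Xkj.
  have Xpp : 0 < X p p by apply: (diag_gt0 (j := k)); rewrite Xsym.
  have pq : p != q by exact: pos_neq Xpp Xpq.
  have [pi|pi] := eqVneq p i; last first.
    by rewrite -(cls p)// -(Xr Xkp).
  by rewrite -(cls q)// -?(Xr Xkq)// -pi eq_sym.
apply: nv; apply: (@four_cycle_vector i l j k) => //; rewrite 1?(eq_sym i l)// 1?(Xsym l)//.
move=> m mi mj mk ml.
have rmi : r m <> r i by move=> e; move/eqP: ml; apply; exact: cls.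
by split; apply: notpos => /Xr e; apply: rmi; rewrite e.
Qed.

End clique.

(** The quadratic form splits over the blocks into the values of [X] at the restrictions of [u] to
    the classes of [r]. *)
Lemma mask_psd n (X : 'M[R]_n) (r : 'I_n -> 'I_n) : psdmx X ->
  psdmx (\matrix_(i, j) if r i == r j then X i j else 0).
Proof.
move=> [XT Xp]; split.
  by apply/matrixP => i j; rewrite !mxE eq_sym -{1}XT mxE.
move=> u; pose m k : 'cV[R]_n := \col_i if r i == k then u i 0 else 0.
rewrite (_ : quad_form _ u = \sum_k quad_form X (m k)); first exact: sumr_ge0.
rewrite quad_formE; under [RHS]eq_bigr do rewrite quad_formE.
rewrite [RHS]exchange_big /=; apply: eq_bigr => i _.
rewrite [RHS]exchange_big /=; apply: eq_bigr => j _.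
rewrite (bigD1 (r i))//= big1 ?addr0 => [|k ki].
  by rewrite !mxE eqxx (eq_sym (r j)); case: ifP; rewrite ?mulr0 ?mul0r.
by rewrite !mxE eq_sym (negbTE ki) !mul0r.
Qed.

Lemma small_outer_le n (X : 'M[R]_n) (x : 'cV[R]_n) (c : R) :
  (forall i j, 0 <= X i j) -> (forall i, 0 <= x i 0) ->
  (forall i j, 0 < x i 0 -> 0 < x j 0 -> 0 < X i j) ->
  exists e, [/\ 0 < e, e * c <= 1 & forall i j, e * (x i 0 * x j 0) <= X i j].
Proof.
move=> X0 x0 xX.
(* The index [None] encodes [e * c <= 1]. The 1 added to the denominators keeps them positive; where
   [X i j] vanishes, so does [x i 0 * x j 0]. *)
pose f (t : option ('I_n * 'I_n)) : R := if t is Some (i, j) then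
  (if 0 < X i j then X i j / (1 + x i 0 * x j 0) else 1) else (1 + `|c|)^-1.
have f0 t : 0 < f t.
  case: t => [[i j]|] /=; last by rewrite invr_gt0 ltr_wpDr.
  by case: ifPn => // Xij; rewrite divr_gt0// ltr_wpDr// mulr_ge0.
pose e := \big[Num.min/1]_t f t.
have ef t : e <= f t by exact: bigmin_le.
have e0 : 0 < e by apply: lt_bigmin => // t _; exact: f0.
exists e; split => //.
  have := ef None; rewrite /= -(ler_pM2r (_ : 0 < 1 + `|c|)) ?ltr_wpDr// mulVf ?gt_eqF
    ?ltr_wpDr//.
  by apply: le_trans; rewrite ler_pM2l// (le_trans (ler_norm c))// lerDr.
move=> i j; have := ef (Some (i, j)); rewrite /=; case: ifPn => [Xij|Xij _].
  have xx : 0 <= x i 0 * x j 0 by rewrite mulr_ge0.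
  rewrite ler_pdivlMr ?ltr_wpDr// => H; apply: le_trans H.
  by rewrite ler_pM2l// lerDr.
suff -> : x i 0 * x j 0 = 0 by rewrite mulr0.
apply/eqP; rewrite mulf_eq0 -[_ || _]negbK negb_or; apply/negP => /andP[xi xj].
by move/negP: Xij; apply; apply: xX; rewrite lt_def ?xi ?xj x0.
Qed.

(** Rescale [Y] to total mass 1; a [Y] of mass 0 is itself 0. *)
Lemma dnn_cone_value_ge n (Q Y : 'M[R]_n) (X : 'M[R]_n) : dnn_optimizer Q X ->
  psdmx Y -> (forall i j, 0 <= Y i j) ->
  mxdot Q X * mxdot (const_mx 1) Y <= mxdot Q Y.
Proof.
move=> [_ mX] [YT Yp] Y0; set s := mxdot _ Y.
have s0 : 0 <= s by rewrite /s mxdot1E sumr_ge0// => i _; rewrite sumr_ge0.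
move: s0; rewrite le_eqVlt => /predU1P[s0|s0].
  rewrite -s0 mulr0 (_ : Y = 0).
    by rewrite mxdotE sumr_ge0// => i _; rewrite sumr_ge0// => j _; rewrite mxE mulr0.
  apply/matrixP => i j; rewrite mxE; apply/eqP; rewrite eq_le Y0 andbT s0 /s mxdot1E.
  rewrite (bigD1 i)//= (bigD1 j)//= -addrA lerDl addr_ge0// ?sumr_ge0// => k _.
  by rewrite sumr_ge0.
rewrite -ler_pdivlMr// mulrC -mxdotZr; apply: mX; split.
- by rewrite mxdotZr mulVf// gt_eqF.
- split; first by rewrite linearZ /= YT.
  move=> v; rewrite /quad_form -scalemxAr -scalemxAl mxE mulr_ge0// ?invr_ge0 ?(ltW s0)//.
  exact: Yp.
- by move=> i j; rewrite mxE mulr_ge0// invr_ge0 ltW.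
Qed.

Lemma quad_form_ge_stqp n (Q : 'M[R]_n) (x : 'cV[R]_n) : (forall i, 0 <= x i 0) ->
  (exists i, 0 < x i 0) ->
  stqp_value Q * (\sum_i x i 0) ^+ 2 <= quad_form Q x.
Proof.
move=> x0 [i xi]; set s := \sum_i _.
have s0 : 0 < s by rewrite /s (bigD1 i)//= ltr_wpDr// sumr_ge0.
have n0 : (0 < n)%N by apply: leq_trans (ltn_ord i).
have [Y mY] := minimizer_exists Q (@dnn_rank_one_compact R n) (@dnn_rank_one_neq0 R n n0).
rewrite stqp_valueE (minimizer_min_value mY).
have := mY.2 ((s^-1 *: x) *m (s^-1 *: x)^T).
rewrite mxdot_outer [quad_form Q (s^-1 *: x)]quad_form_bilin bilinZl bilinZr -quad_form_bilin.
rewrite -ler_pdivlMr ?exprn_gt0//.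
have -> : quad_form Q x / s ^+ 2 = s^-1 * (s^-1 * quad_form Q x).
  by field; rewrite gt_eqF.
apply.
apply/dnn_rank_oneE; exists (s^-1 *: x) => //; split.
  by move=> j; rewrite mxE mulr_ge0// invr_ge0 ltW.
by under eq_bigr do rewrite mxE; rewrite -mulr_sumr mulVf// gt_eqF.
Qed.

(* If the optimizer [X] beat the standard quadratic program, then so would its
   restriction to the diagonal blocks given by the components of [e]; since these
   have order at most 4, one can subtract a multiple of a nonnegative [x x^T]
   from it, and the remainder would do even better. *)
Lemma dnn_exact_small_components n (Q : 'M[R]_n) (e : rel 'I_n) : (0 < n)%N ->
  symmetric e -> (forall i, #|[pred j | connect e i j]| <= 4)%N ->
  (forall i j, ~~ e i j -> exists k, Q k k <= Q i j) -> dnn_exact Q.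
Proof.
move=> n0 e_sym e4 Qe.
have [Z mZ] := minimizer_exists Q (@dnn_rank_one_compact R n) (@dnn_rank_one_neq0 R n n0).
have [X mX] : exists X, dnn_optimizer Q X.
  by apply: (minimizer_exists Q (@dnn_feasible_compact R n)); exists Z; exact: mZ.1.1.
rewrite /dnn_exact; have lE : stqp_value Q = mxdot Q Z by rewrite stqp_valueE
  (minimizer_min_value mZ).
set l := stqp_value Q in lE *.
rewrite /dnn_value (minimizer_min_value mX); set m := mxdot Q X.
apply/eqP; rewrite eq_le; apply/andP; split; first by rewrite lE; apply: mX.2; exact: mZ.1.1.
rewrite leNgt; apply/negP => ml.
have Qdiag k : l <= Q k k.
  have := @quad_form_ge_stqp n Q (delta_mx k 0); rewrite quad_form_delta (bigD1 k)//= mxE eqxx.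
  rewrite big1 => [|i ik]; last by rewrite mxE (negbTE ik).
  rewrite addr0 expr1n mulr1; apply; first by move=> i; rewrite mxE ler0n.
  by exists k; rewrite mxE !eqxx.
pose r i := fingraph.root e i.
have cs : connect_sym e by exact: sym_connect_sym.
pose X' : 'M[R]_n := \matrix_(i, j) if r i == r j then X i j else 0.
have [[X1 Xp X0] _] := mX.
have X'p : psdmx X' by exact: mask_psd.
have X'0 i j : 0 <= X' i j by rewrite mxE; case: ifP.
have X'r i j : 0 < X' i j -> r i = r j by rewrite mxE; case: eqP => // _; rewrite ltxx.
have r4 i : (#|[pred j | r j == r i]| <= 4)%N.
  apply: leq_trans (e4 i); apply: subset_leq_card; apply/fintype.subsetP => j.
  by rewrite !inE /r root_connect// cs.
(* The excess of the objective over [l] times the mass. Deleting entries between classes does not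
   increase it, since there [Q i j] is at least some [Q k k], hence at least [l]. *)
pose L Y := mxdot Q Y - l * mxdot (const_mx 1) Y.
have LX' : L X' <= L X.
  rewrite /L !mxdot1E !mxdotE !mulr_sumr -!sumrB; apply: ler_sum => i _.
  rewrite !mulr_sumr -!sumrB; apply: ler_sum => j _; rewrite mxE.
  case: ifPn => // rij; rewrite !mulr0 subr0 -mulrBl mulr_ge0// subr_ge0.
  have [|k] := Qe i j; last exact: le_trans.
  by apply: contra rij => /connect1; rewrite -root_connect.
have cone Y : psdmx Y -> (forall i j, 0 <= Y i j) -> (m - l) * mxdot (const_mx 1) Y <= L Y.
  by move=> Yp Y0; rewrite /L mulrBl lerD2r; exact: dnn_cone_value_ge.
have LX : L X = m - l by rewrite /L X1 mulr1.
(* As [m - l] is negative, [m - l] times the mass of [X'] being at most [L X' <= m - l] forces that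
   mass to be at least 1. *)
have s1 : 1 <= mxdot (const_mx 1) X'.
  have := cone _ X'p X'0; move: LX'; rewrite LX => H /le_trans /(_ H).
  by rewrite -{2}[m - l]mulr1 ler_nM2l// subr_lt0.
have s1' : mxdot (const_mx 1) X' <= 1.
  rewrite -[leRHS]X1 !mxdot1E; apply: ler_sum => i _; apply: ler_sum => j _; rewrite mxE.
  by case: ifP.
have [i Xii] : exists i, 0 < X' i i.
  apply: contrapT => nX; move: s1; rewrite mxdot1E big1 ?ler10// => i _; rewrite big1// => j _.
  have Xii k : X' k k = 0.
    by apply/eqP; rewrite eq_le X'0 andbT leNgt; apply/negP => Xk; apply: nX; exists k.
  by have := psd_entry_sqr i j X'p; rewrite Xii mul0r => H; apply/eqP; rewrite -sqrf_eq0
    eq_le H sqr_ge0.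
have [v [x0 xpos xcl]] := clique_vector_exists X'p X'0 X'r r4 Xii.
have [t [t0 tv tx]] := small_outer_le (quad_form X' v) X'0 x0 xcl.
set x := X' *m v in x0 xpos xcl tx.
have Yp := psd_sub_outer X'p (ltW t0) tv; rewrite -/x in Yp.
have Y0 a b : 0 <= (X' - t *: (x *m x^T)) a b.
  by rewrite !mxE big_ord1 !mxE subr_ge0; have := tx a b; rewrite !mxE.
have := cone _ Yp Y0.
have -> : X' - t *: (x *m x^T) = X' + (- t) *: (x *m x^T) by rewrite scaleNr.
rewrite /L !mxdotDr !mxdotZr mxdot1_outer mxdot_outer.
have := quad_form_ge_stqp Q x0 xpos; rewrite -/l.
have : 0 < (\sum_i x i 0) ^+ 2.
  have [k xk] := xpos; rewrite exprn_gt0// (bigD1 k)//= ltr_wpDr// sumr_ge0//.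
move: LX'; rewrite LX /L.
have ml' : m - l < 0 by rewrite subr_lt0.
move: (mxdot Q X') (mxdot (const_mx 1) X') s1 s1' ((\sum_i x i 0) ^+ 2) (quad_form Q x).
move=> qX' sX' s1 s1' S q H1 S0 H2 H3.
have sX'1 : sX' = 1 by apply/eqP; rewrite eq_le s1 s1'.
subst sX'.
(* The subtraction lowers the mass by [t * S] and the excess by the nonnegative [t * (q - l * S)];
   the cone inequality would then make [t * ((l - m) * S)] nonpositive. *)
have H4 : 0 < t * ((l - m) * S) by rewrite !mulr_gt0// subr_gt0.
have H5 : 0 <= t * (q - l * S) by rewrite mulr_ge0 ?subr_ge0// ltW.
clear -H1 H3 H4 H5; lra.
Qed.

(** A tree recorded in the order of its growth: vertex k + 1, written [lift ord0 k], is attached to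
    its parent [p k] among the vertices 0, ..., k. *)
Definition tree5 n (e : rel 'I_n) (u : {ffun 'I_5 -> 'I_n}) (p : {ffun 'I_4 -> 'I_5}) : bool :=
  injectiveb u && [forall k : 'I_4, (p k <= k)%N && e (u (p k)) (u (lift ord0 k))].

Lemma connect_exit n (e : rel 'I_n) (S : pred 'I_n) x y : connect e x y -> S x -> ~~ S y ->
  exists a b, [/\ S a, ~~ S b, connect e x a & e a b].
Proof.
move=> /connectP[s]; elim: s x => [|z s IH] x /= => [_ ->|/andP[exz ps] yE] Sx Sy.
  by rewrite Sx in Sy.
have [Sz|Sz] := boolP (S z); last by exists x, z; split.
have [a [b [Sa Sb za ab]]] := IH z ps yE Sz Sy.
by exists a, b; split => //; apply: connect_trans (connect1 exz) za.
Qed.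

(** While the component has more vertices than the tree, some path in it leaves the tree; the first
    edge out gives the new vertex and its parent. Only the values of [u] up to [m] matter. *)
Lemma grow_tree n (e : rel 'I_n) i m : (m < #|[pred j | connect e i j]|)%N ->
  exists u : nat -> 'I_n, [/\ forall a b, (a <= m)%N -> (b <= m)%N -> u a = u b -> a = b,
    forall k, (k < m)%N -> exists2 p, (p <= k)%N & e (u p) (u k.+1),
    u 0%N = i & forall a, (a <= m)%N -> connect e i (u a)].
Proof.
elim: m => [|m IH] mc.
  exists (fun=> i); split => [a b|//|//|a _]; last exact: connect0.
  by rewrite !leqn0 => /eqP -> /eqP ->.
have [u [uinj upar u0 uc]] := IH (ltnW mc).
pose S : pred 'I_n := [pred y | [exists a : 'I_m.+1, u a == y]].
have [y cy Sy] : exists2 y, connect e i y & ~~ S y.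
  apply: contrapT => H; move: mc; rewrite ltnNge => /negP; apply.
  have : (#|[pred j | connect e i j]| <= #|codom (fun a : 'I_m.+1 => u a)|)%N.
    apply: subset_leq_card; apply/fintype.subsetP => y; rewrite inE => cy.
    have : S y by apply: contrapT => /negP Sy; apply: H; exists y.
    by move=> /existsP[a /eqP <-]; exact: codom_f.
  move=> /leq_trans; apply; rewrite (leq_trans (card_size _))// size_codom card_ord//.
have [|a [b [Sa Sb ca ab]]] := connect_exit (S := S) cy _ Sy.
  by apply/existsP; exists ord0; rewrite /= u0.
have ub k : (k <= m)%N -> u k != b.
  move=> km; apply: contra Sb => /eqP <-; apply/existsP.
  by exists (Ordinal (km : (k < m.+1)%N)).
have leS k : (k <= m.+1)%N = (k == m.+1) || (k <= m)%N by rewrite leq_eqVlt ltnS.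
exists (fun k => if k == m.+1 then b else u k); split => //.
- move=> k l; rewrite !leS.
  case: eqP => [-> _|_ /= km]; case: eqP => [-> _|_ /= lm] //.
  + by move=> /esym/eqP; rewrite (negbTE (ub _ lm)).
  + by move=> /eqP; rewrite (negbTE (ub _ km)).
  + exact: uinj.
- move=> k; rewrite ltnS leq_eqVlt => /predU1P[->|km].
    move/existsP: Sa => [c /eqP ca']; exists c; first by rewrite -ltnS.
    by rewrite eqxx ca' ifN// neq_ltn ltn_ord.
  have [p pk ep] := upar k km; exists p => //.
  have -> : (p == m.+1) = false by rewrite ltn_eqF// ltnS (leq_trans pk)// ltnW.
  by rewrite eqSS ltn_eqF.
- move=> k; rewrite leS; case: eqP => [_ _|_ /= km]; last exact: uc.
  exact: connect_trans ca (connect1 ab).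
Qed.

Lemma no_tree5_components n (e : rel 'I_n) :
  (forall u p, ~~ tree5 e u p) -> forall i, (#|[pred j | connect e i j]| <= 4)%N.
Proof.
move=> H i; rewrite leqNgt; apply/negP => /grow_tree[u [uinj upar _ _]].
have [p Hp] : exists p : {ffun 'I_4 -> 'I_5}, forall k, (p k <= k)%N /\ e (u (p k)) (u k.+1).
  have /choice[p Hp] : forall k : 'I_4, exists p : 'I_5, (p <= k)%N /\ e (u p) (u k.+1).
    move=> k; have [p pk ep] := upar k (ltn_ord k).
    have p5 : (p < 5)%N by apply: leq_ltn_trans pk (ltn_trans (ltn_ord k) _).
    by exists (Ordinal p5).
  by exists (finfun p) => k; rewrite ffunE.
have := H [ffun a : 'I_5 => u a] p; rewrite /tree5 negb_and => /orP[/negP|/negP]; apply.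
  apply/injectiveP => a b; rewrite !ffunE => /uinj ab; apply/val_inj/ab.
    by rewrite -ltnS.
  by rewrite -ltnS.
by apply/forallP => k; have [pk ek] := Hp k; rewrite pk !ffunE.
Qed.

Definition below_diag n (Q : 'M[R]_n) : rel 'I_n :=
  fun i j => (i != j) && [forall k, Q i j < Q k k].

Lemma dnn_exact_no_tree5 n (Q : 'M[R]_n) : (0 < n)%N -> Q^T = Q ->
  (forall u p, ~~ tree5 (below_diag Q) u p) -> dnn_exact Q.
Proof.
move=> n0 QT H; apply: (@dnn_exact_small_components _ _ (below_diag Q)) => //.
- by move=> i j; rewrite /below_diag eq_sym -{1}QT mxE.
- exact: no_tree5_components.
- move=> i j; rewrite /below_diag negb_and negbK => /orP[/eqP <-|]; first by exists i.
  by rewrite negb_forall => /existsP[k]; rewrite -leNgt; exists k.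
Qed.

End exactness.

(** * Gaussian tails *)

Section gauss.
Context {R : realType}.
Notation mu := (@lebesgue_measure R).

Lemma integral_exp_tail (r t : R) : 0 < r ->
  (\int[mu]_(x in `]-oo, (- t)%R]) (r * expR (r * x))%:E = (expR (- r * t))%:E)%E.
Proof.
move=> r0.
have cexp (a : R) : continuous (fun z : R => expR (a * z)).
  move=> z; apply: continuous_comp; last exact: continuous_expR.
  by apply: (@continuousM R _ (fun=> a) id); [exact: cst_continuous|].
have crexp (a : R) : continuous (fun z : R => r * expR (a * z)).
  by move=> z; apply: (@continuousM R _ (fun=> r) (fun z => expR (a * z))); [exact:
    cst_continuous|exact: cexp].
rewrite ge0_integration_by_substitutionNy; last 2 first.
- by apply: continuous_subspaceT; exact: crexp.
- by move=> x _; rewrite mulr_ge0 ?expR_ge0// ltW.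
rewrite (_ : (fun _ => _) \o _ = fun x => r * expR (- r * x)); last first.
  by apply/funext => x /=; rewrite mulrN mulNr.
rewrite (@ge0_continuous_FTC2y _ _ (fun x => - expR (- r * x)) _ 0)//.
- by rewrite EFinN oppeK add0e.
- by move=> x _; rewrite mulr_ge0 ?expR_ge0// ltW.
- by apply: continuous_subspaceT; exact: crexp.
- rewrite -oppr0; apply: cvgN.
  rewrite (_ : (fun x => expR (- r * x)) =
               (fun z => expR (- z)) \o (fun z => r * z)); last first.
    by apply: eq_fun => x; rewrite mulNr.
  apply: (@cvg_comp _ _ _ _ _ _ (pinfty_nbhs R)); last exact: cvgr_expR.
  exact: gt0_cvgMry.
- by apply: cvgN; apply/cvg_at_right_filter; exact: cexp.
- move=> z _.
  rewrite derive1_comp// derive1N// derive1_id mulN1r derive1_comp// derive1E.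
  have /funeqP -> := @derive_expR R.
  by rewrite derive1Ml// derive1_id mulr1 mulrN opprK mulrC.
Qed.

(** The density with variance 1/2 is exp(-x^2)/sqrt(pi). Since (x + t)^2 >= 0, it is at most exp(t^2
    + 2tx), whose integral is elementary. *)
Lemma normal_half_tail_le (t : R) : 0 < t ->
  (normal_prob 0 (Num.sqrt 2^-1) `]-oo, (- t)%R[ <= (expR (- t ^+ 2) / (2 * t))%:E)%E.
Proof.
move=> t0; have s0 : Num.sqrt 2^-1 != 0 :> R by rewrite gt_eqF// sqrtr_gt0 invr_gt0.
pose c := expR (t ^+ 2) / (2 * t).
have c0 : 0 <= c by rewrite divr_ge0 ?expR_ge0// mulr_ge0// ltW.
have t20 : 0 < 2 * t by rewrite mulr_gt0.
have me : measurable_fun setT (fun x : R => expR (2 * t * x)).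
  by apply: measurableT_comp => //; exact: measurable_funM.
apply: (@le_trans _ _ (\int[mu]_(x in `]-oo, (- t)%R]) (c%:E * (2 * t * expR (2 * t *
  x))%:E))%E); last first.
  rewrite ge0_integralZl_EFin//=; last 2 first.
  - by move=> x _; rewrite lee_fin mulr_ge0 ?expR_ge0// ltW.
  - by apply/measurable_EFinP/measurable_funTS/measurable_funM.
  rewrite integral_exp_tail// -EFinM lee_fin /c mulrAC -expRD.
  by rewrite le_eqVlt; apply/orP; left; apply/eqP; congr (expR _ / _); ring.
rewrite /normal_prob.
apply: (@le_trans _ _ (\int[mu]_(x in `]-oo, (- t)%R]) (normal_pdf 0 (Num.sqrt 2^-1) x)%:E)%E).
  apply: ge0_subset_integral => //=.
  - by apply/measurable_EFinP/measurable_funTS; exact: measurable_normal_pdf.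
  - by move=> x _; rewrite lee_fin normal_pdf_ge0.
  - by move=> x /=; rewrite !in_itv /=; exact: ltW.
apply: ge0_le_integral => //=.
- by move=> x _; rewrite lee_fin normal_pdf_ge0.
- by apply/measurable_EFinP/measurable_funTS; exact: measurable_normal_pdf.
- apply/measurable_EFinP/measurable_funTS; apply: measurable_funM => //.
  exact: measurable_funM.
- move=> x; rewrite in_itv /= => xt; rewrite -EFinM lee_fin normal_pdfE// /normal_fun
  /normal_peak.
  have ss : Num.sqrt 2^-1 ^+ 2 = 2^-1 :> R by rewrite sqr_sqrtr// invr_ge0.
  rewrite ss subr0.
  have -> : 2^-1 *+ 2 = 1 :> R by field.
  have -> : 2^-1 * pi *+ 2 = pi :> R by field.
  rewrite divr1.
  have -> : c * (2 * t * expR (2 * t * x)) = expR (t ^+ 2 + 2 * t * x).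
    by rewrite /c mulrA mulfVK ?gt_eqF// expRD.
  have p1 : 1 <= Num.sqrt pi :> R.
    rewrite -[leLHS]sqrtr1 ler_wsqrtr//; apply: le_trans (pi_ge2 R).
    by rewrite ler1n.
  apply: (@le_trans _ _ (expR (- x ^+ 2))).
    by rewrite ler_piMl ?expR_ge0// invf_le1// (lt_le_trans ltr01).
  by rewrite ler_expR; nra.
Qed.

(** Keep only the interval of length 1/t to the left of -t, where x^2 <= (t + 1/t)^2 <= t^2 + 3
    because t >= 1. *)
Lemma normal_tail_ge (t : R) : 1 <= t ->
  (((normal_peak 1 * expR (- (3 / 2))) / t * expR (- (t ^+ 2 / 2)))%:E <=
   normal_prob 0 (Num.sqrt 1) `]-oo, (- t)%R[)%E.
Proof.
move=> t1; have t0 : 0 < t by exact: lt_le_trans t1.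
have s0 : Num.sqrt 1 != 0 :> R by rewrite sqrtr1 oner_eq0.
rewrite /normal_prob.
apply: (@le_trans _ _ (\int[mu]_(x in `[(- t - t^-1)%R, (- t)%R[) (normal_pdf 0 (Num.sqrt 1)
  x)%:E)%E); last first.
  apply: ge0_subset_integral => //=.
  - by apply/measurable_EFinP/measurable_funTS; exact: measurable_normal_pdf.
  - by move=> x _; rewrite lee_fin normal_pdf_ge0.
  - by move=> x /=; rewrite !in_itv /= => /andP[].
pose c := normal_peak 1 * expR (- (3 / 2)) * expR (- (t ^+ 2 / 2)).
apply: (@le_trans _ _ (\int[mu]_(x in `[(- t - t^-1)%R, (- t)%R[) c%:E)%E).
  rewrite integral_cst//= lebesgue_measure_itv /= lte_fin ltrBlDr ltrDl invr_gt0 t0.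
  rewrite -EFinD -EFinM lee_fin (_ : - t - (- t - t^-1) = t^-1) /c; last by ring.
  by rewrite le_eqVlt; apply/orP; left; apply/eqP; ring.
apply: ge0_le_integral => //=.
- by move=> x _; rewrite lee_fin !mulr_ge0 ?expR_ge0// normal_peak_ge0.
- by apply/measurable_EFinP/measurable_funTS; exact: measurable_normal_pdf.
- move=> x; rewrite in_itv /= => /andP[x1 x2]; rewrite lee_fin normal_pdfE// sqrtr1 /normal_fun.
  rewrite /c -mulrA ler_wpM2l ?normal_peak_ge0// -expRD ler_expR subr0 expr1n.
  have tV : t^-1 <= 1 by rewrite invf_le1.
  have tV0 : 0 <= t^-1 by rewrite invr_ge0 ltW.
  have tVt : t * t^-1 = 1 by rewrite mulfV// gt_eqF.
  have x3 : x ^+ 2 <= (t + t^-1) ^+ 2 by nra.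
  have x4 : (t + t^-1) ^+ 2 <= t ^+ 2 + 3 by nra.
  have -> : - (3 / 2) - t ^+ 2 / 2 = - (t ^+ 2 + 3) / (1 *+ 2) by field.
  by rewrite !mulNr lerN2 ler_wpM2r ?invr_ge0//; exact: le_trans x4.
Qed.

End gauss.

(** * Asymptotics of the slicing sum *)

Section estimates.
Context {R : realType}.

(** Choose a with a <= 1 and ma <= c. Then a(1 + y) <= 1 + ay <= exp(ay), and the m-th power is at
    most exp(cy). *)
Lemma poly_exp_bounded (c : R) (m : nat) : 0 < c ->
  exists C, 0 < C /\ forall y, 0 <= y -> (1 + y) ^+ m * expR (- c * y) <= C.
Proof.
move=> c0; pose a : R := Num.min 1 (c / m.+1%:R).
have a0 : 0 < a by rewrite lt_min ltr01 divr_gt0.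
have a1 : a <= 1 by rewrite ge_min lexx.
have ac : a <= c / m.+1%:R by rewrite ge_min lexx orbT.
exists (a^-1 ^+ m); split; first by rewrite exprn_gt0// invr_gt0.
move=> y y0; rewrite mulNr expRN -ler_pdivlMr ?invr_gt0 ?expR_gt0// invrK.
rewrite -ler_pdivrMl ?exprn_gt0 ?invr_gt0// -exprVn invrK -exprMn.
apply: (@le_trans _ _ (expR (a * y) ^+ m)).
  apply: lerXn2r; rewrite ?nnegrE ?expR_ge0//; first by rewrite mulr_ge0 ?addr_ge0// ltW.
  by apply: le_trans (expR_ge1Dx _); rewrite mulrDr mulr1 lerD2r.
rewrite -expRM_natl ler_expR mulrA ler_wpM2r//.
apply: (@le_trans _ _ (m.+1%:R * a)); first by rewrite ler_wpM2r ?ler_nat// ltW.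
by rewrite mulrC -ler_pdivlMr.
Qed.

(* Along a geometric progression the summand is dominated by the increments of
   the bounded function [y |-> - 1 / (1 + y)]. *)
Lemma geometric_sum_bounded (c : R) : 0 < c ->
  exists C, 0 < C /\ forall y0, 0 < y0 -> forall N,
    \sum_(k < N) (expR k%:R * y0) ^+ 8 * expR (- c * (expR k%:R * y0)) <= C.
Proof.
(* The exponent is 7 + 2: [z ^+ 8] is at most [z * (1 + z) ^+ 7], and two factors come from the
   denominators of the increment. *)
move=> c0; have [C [C0 CP]] := @poly_exp_bounded c 9 c0.
pose e : R := expR 1.
have e2 : 2 <= e by apply: le_trans (expR_ge1Dx _); rewrite -[2]/(1 + 1).
have e0 : 0 < e by exact: lt_le_trans e2.
exists (C * e); split; first by rewrite mulr_gt0.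
move=> y0 y00 N; pose y (k : nat) := expR k%:R * y0.
have y_gt0 k : 0 < y k by rewrite mulr_gt0 ?expR_gt0.
have yS k : y k.+1 = e * y k by rewrite /y -natr1 expRD mulrA (mulrC e).
apply: (@le_trans _ _ (\sum_(k < N) (C * e * ((1 + y k)^-1 - (1 + y k.+1)^-1)))).
  apply: ler_sum => k _; rewrite -/(y k) yS; have yk := y_gt0 k.
  move: (y k) yk (CP _ (ltW yk)) => z z0 Cz.
  have H1 : 0 < 1 + z by rewrite addr_gt0.
  have H2 : 0 < 1 + e * z by rewrite addr_gt0// mulr_gt0.
  have -> : (1 + z)^-1 - (1 + e * z)^-1 = (e - 1) * z / ((1 + z) * (1 + e * z)).
    by field; rewrite !gt_eqF.
  rewrite mulrA ler_pdivlMr ?mulr_gt0//.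
  have H3 : z ^+ 8 * expR (- c * z) * ((1 + z) * (1 + e * z)) <=
     z * e * ((1 + z) ^+ 9 * expR (- c * z)).
    have -> : z * e * ((1 + z) ^+ 9 * expR (- c * z)) =
       (z * (1 + z) ^+ 7) * expR (- c * z) * ((1 + z) * (e * (1 + z))) by ring.
    have z7 : z ^+ 8 <= z * (1 + z) ^+ 7.
      rewrite exprS ler_pM2l//; apply: lerXn2r; rewrite ?nnegrE ?ltW//.
      by rewrite ltrDr.
    apply: ler_pM.
    - by rewrite mulr_ge0 ?expR_ge0// exprn_ge0// ltW.
    - by rewrite ltW// mulr_gt0.
    - by rewrite ler_pM2r ?expR_gt0.
    by rewrite ler_pM2l// mulrDr mulr1 lerD2r (le_trans _ e2)// ler1n.
  apply: (le_trans H3).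
  have H4 : z * e * ((1 + z) ^+ 9 * expR (- c * z)) <= z * e * C.
    by rewrite ler_pM2l// mulr_gt0.
  apply: (le_trans H4).
  have -> : C * e * ((e - 1) * z) = z * e * C * (e - 1) by ring.
  have zeC : 0 <= z * e * C by rewrite ltW// !mulr_gt0.
  by rewrite ler_peMr//; lra.
have -> : \sum_(k < N) C * e * ((1 + y k)^-1 - (1 + y k.+1)^-1) =
    C * e * ((1 + y 0)^-1 - (1 + y N)^-1).
  elim: (N) => [|m IH]; first by rewrite big_ord0 subrr mulr0.
  by rewrite big_ord_recr /= IH; ring.
have Ce0 : 0 <= C * e by rewrite mulr_ge0// ltW.
rewrite ler_piMr//.
apply: (@le_trans _ _ (1 + y 0%N)^-1); first by rewrite gerBl invr_ge0 addr_ge0// ltW.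
by rewrite invf_le1 ?addr_gt0// lerDl ltW.
Qed.

(** Put T = 4u. Since exp(T) >= u^4, the negated left exponent is at least [b * u ^+ 3], which
    dominates 4T^2 up to an additive constant. *)
Lemma double_exp_bounded (c : R) : 0 < c ->
  exists C, 0 < C /\ forall T, 0 < T ->
    expR (- c * (expR (T - 1) / T)) <= C * expR (- (4 * T ^+ 2)).
Proof.
move=> c0; pose b := c / (4 * expR 1).
have b0 : 0 < b by rewrite divr_gt0// mulr_gt0 ?expR_gt0.
pose k : R := 4 ^+ 3; have k0 : 0 < k by rewrite exprn_gt0.
(* Here 4T^2 = k u^2. [B] bounds it as long as u <= k/b; beyond that the cubic term does. *)
pose B := k * (k / b) ^+ 2; have B0 : 0 <= B by rewrite mulr_ge0 ?exprn_ge0 ?divr_ge0 ?ltW.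
exists (expR B); split; first exact: expR_gt0.
move=> T T0; rewrite -expRD ler_expR.
have [u [u0 TE]] : exists u, 0 < u /\ T = 4 * u.
  by exists (T / 4); split; [rewrite divr_gt0|field].
have H1 : u ^+ 4 <= expR T.
  rewrite TE expRM_natl; apply: lerXn2r; rewrite ?nnegrE ?expR_ge0 ?ltW//.
  by apply: lt_le_trans (expR_ge1Dx _); rewrite ltrDr.
have H2 : b * u ^+ 3 <= c * (expR (T - 1) / T).
  have -> : b * u ^+ 3 = c * (u ^+ 4 / expR 1 / T).
    by rewrite /b TE; field; rewrite !gt_eqF ?expR_gt0.
  rewrite ler_pM2l// ler_pM2r ?invr_gt0// expRB ler_pM2r// invr_gt0 expR_gt0.
have H3 : 4 * T ^+ 2 <= B + b * u ^+ 3.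
  have -> : 4 * T ^+ 2 = k * u ^+ 2 by rewrite TE /k; ring.
  have [ub|ub] := leP u (k / b).
    apply: (@le_trans _ _ B); last by rewrite lerDl mulr_ge0 ?exprn_ge0 ?ltW.
    rewrite /B ler_pM2l//; apply: lerXn2r => //; rewrite nnegrE ?ltW//.
    by rewrite divr_gt0.
  apply: (@le_trans _ _ (b * u ^+ 3)); last by rewrite lerDr.
  have : k < b * u by rewrite mulrC -ltr_pdivrMr.
  have -> : b * u ^+ 3 = b * u * u ^+ 2 by ring.
  by move=> /ltW H; rewrite ler_wpM2r// exprn_ge0// ltW.
by rewrite mulNr; lra.
Qed.

Definition normal_cdf (s x : R) : R := fine (normal_prob 0 s `]-oo, x[).

Lemma normal_cdfE (s x : R) : normal_prob 0 s `]-oo, x[ = (normal_cdf s x)%:E.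
Proof. by rewrite fineK// fin_num_measure. Qed.

Lemma normal_cdf_ge0 (s x : R) : 0 <= normal_cdf s x.
Proof. by rewrite fine_ge0. Qed.

Lemma normal_cdf_le1 (s x : R) : normal_cdf s x <= 1.
Proof. by rewrite -lee_fin -normal_cdfE; exact: probability_le1. Qed.

(* The four edges of a tree lie below the minimum [m] of the diagonal. Slicing
   the range of [m] by the thresholds [a k], this bounds the probability of that
   event; the slices [- T + k / T], where [T = sqrt (2 ln n)], match the scale of
   the fluctuations of the minimum of [n] standard normal variables. *)
Definition slicing_sum (n N : nat) (a : nat -> R) : R :=
  normal_cdf (Num.sqrt 2^-1) (a 0) ^+ 4 +
  \sum_(k < N) (1 - normal_cdf (Num.sqrt 1) (a k)) ^+ n *
    normal_cdf (Num.sqrt 2^-1) (a k.+1) ^+ 4 +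
  (1 - normal_cdf (Num.sqrt 1) (a N)) ^+ n.

Lemma onem_expn_le (q : R) n : 0 <= q <= 1 -> (1 - q) ^+ n <= expR (- (n%:R * q)).
Proof.
move=> /andP[q0 q1]; rewrite -mulrN expRM_natl.
by apply: lerXn2r; rewrite ?nnegrE ?expR_ge0 ?subr_ge0//; exact: expR_ge1Dx.
Qed.

(** Let T = sqrt(2 ln n), so 1/n = exp(-T^2/2), and y_k = exp(k)/T. An edge lies below -T + k/T with
    probability at most n^-2 T y_k^2, and the whole diagonal lies above it with probability at most
    exp(-c1 y_k). This leaves n^-8 T^4 times a bounded sum of y_k^8 exp(-c1 y_k). *)
Lemma slicing_sum_le : exists C, exists n0 : nat, 0 < C /\ forall n, (n0 <= n)%N ->
  exists N a, slicing_sum n N a <= C * (ln n%:R ^+ 2 / n%:R ^+ 8).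
Proof.
(* The last factor absorbs exp(-z^2/2) for z = k/T at most 1; the others come from
   [normal_tail_ge]. *)
pose c1 : R := normal_peak 1 * expR (- (3 / 2)) * expR (- (1 / 2)).
have c10 : 0 < c1 by rewrite !mulr_gt0 ?expR_gt0// normal_peak_gt0// oner_eq0.
have [C1 [C10 C1P]] := geometric_sum_bounded c10.
have [C2 [C20 C2P]] := double_exp_bounded c10.
(* For n >= exp(2) one has ln n >= 2 and T >= 2. The factor 4 comes from T^4 = 4 (ln n)^2. *)
exists (4 * (1 + expR 8 * C1 + C2)), (Num.truncn (expR 2 : R)).+1.
split; first by rewrite mulr_gt0// !addr_gt0// mulr_gt0// expR_gt0.
move=> n nn0.
have ne2 : expR 2 <= n%:R :> R.
  apply: (le_trans (ltW (truncnS_gt _))); by rewrite ler_nat.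
have n0 : 0 < n%:R :> R by apply: lt_le_trans ne2; exact: expR_gt0.
have L2 : 2 <= ln n%:R :> R by rewrite -[leLHS]expRK ler_ln ?posrE ?expR_gt0.
pose T : R := Num.sqrt (2 * ln n%:R).
have TT : T ^+ 2 = 2 * ln n%:R by rewrite sqr_sqrtr// mulr_ge0// (le_trans _ L2).
have T2 : 2 <= T.
  rewrite -[leLHS]ger0_norm// -sqrtr_sqr ler_wsqrtr//.
  by rewrite expr2 ler_pM2l.
have T0 : 0 < T by exact: lt_le_trans T2.
have En : expR (- (T ^+ 2 / 2)) = n%:R^-1.
  by rewrite TT mulrAC mulfV// mul1r expRN lnK// posrE.
have ET2 : expR (- T ^+ 2) = n%:R^-1 ^+ 2.
  by rewrite -En -expRM_natl; congr expR; field.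
(* Then every shift k/T is at most 1, so T - k/T is at least 1 and at least T/2. *)
pose N := Num.truncn T.
have /andP[NT TN] : N%:R <= T < N.+1%:R by apply: truncn_itv; exact: ltW.
pose a (k : nat) : R := - (T - k%:R / T).
pose y (k : nat) : R := expR k%:R * T^-1.
have y0 k : 0 < y k by rewrite mulr_gt0 ?expR_gt0 ?invr_gt0.
have kT k : (k <= N)%N -> k%:R / T <= 1.
  by move=> kN; rewrite ler_pdivrMr// mul1r (le_trans _ NT)// ler_nat.
have pk k : (k <= N)%N -> normal_cdf (Num.sqrt 2^-1) (a k) <= n%:R^-1 ^+ 2 * T * y k ^+ 2.
  move=> /kT; set z := k%:R / T => z1.
  have z0 : 0 <= z by rewrite divr_ge0// ltW.
  have t0 : 0 < T - z by lra.
  have tT : T <= 2 * (T - z) by lra.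
  rewrite -lee_fin -normal_cdfE; apply: (le_trans (normal_half_tail_le t0)); rewrite lee_fin.
  apply: (@le_trans _ _ (expR (- T ^+ 2) * expR k%:R ^+ 2 / T)).
    apply: ler_pM; [exact: expR_ge0|by rewrite invr_ge0 mulr_ge0// ltW| |]; last first.
      by rewrite lef_pV2// posrE// mulr_gt0.
    rewrite -expRM_natl -expRD ler_expR.
    have -> : k%:R = z * T by rewrite /z divfK// gt_eqF.
    have := sqr_ge0 z; rewrite !expr2; lra.
  by rewrite ET2 /y le_eqVlt; apply/orP; left; apply/eqP; field; rewrite !gt_eqF.
have qk k : (k <= N)%N -> (1 - normal_cdf (Num.sqrt 1) (a k)) ^+ n <= expR (- c1 * y k).
  move=> kN; have := kT k kN; set z := k%:R / T => z1.
  have z0 : 0 <= z by rewrite divr_ge0// ltW.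
  have t1 : 1 <= T - z by lra.
  have t0 : 0 < T - z by lra.
  apply: (le_trans (onem_expn_le _ _)); first by rewrite normal_cdf_ge0 normal_cdf_le1.
  rewrite ler_expR mulNr lerN2.
  have := normal_tail_ge t1; rewrite normal_cdfE lee_fin -/(a k) => H.
  rewrite -ler_pdivrMl//; apply: le_trans H.
  set g := normal_peak 1 * expR (- (3 / 2)).
  have g0 : 0 <= g by rewrite mulr_ge0 ?expR_ge0// normal_peak_ge0.
  rewrite /c1 -/g /y.
  have -> : n%:R^-1 * (g * expR (- (1 / 2)) * (expR k%:R / T)) =
     g / T * (expR (- (1 / 2)) * expR k%:R * expR (- (T ^+ 2 / 2))).
    by rewrite En; ring.
  apply: ler_pM.
  - by rewrite mulr_ge0// invr_ge0 ltW.
  - by rewrite !mulr_ge0 ?expR_ge0.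
  - by rewrite ler_wpM2l// lef_pV2 ?posrE//; lra.
  - rewrite -!expRD ler_expR.
    have -> : k%:R = z * T by rewrite /z divfK// gt_eqF.
    have : z ^+ 2 <= 1 by rewrite expr_le1.
    by rewrite !expr2; lra.
pose M := n%:R^-1 ^+ 8 * T ^+ 4.
have M0 : 0 < M by rewrite mulr_gt0 ?exprn_gt0 ?invr_gt0.
exists N, a.
have -> : 4 * (1 + expR 8 * C1 + C2) * (ln n%:R ^+ 2 / n%:R ^+ 8) = M * (1 + expR 8 * C1 + C2).
  have -> : ln n%:R = T ^+ 2 / 2 by rewrite TT; field.
  by rewrite /M; field; rewrite gt_eqF.
rewrite /slicing_sum mulrDr mulrDr mulr1; apply: lerD; first apply: lerD.
- apply: (@le_trans _ _ ((n%:R^-1 ^+ 2 * T * y 0%N ^+ 2) ^+ 4)).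
    apply: lerXn2r; rewrite ?nnegrE ?normal_cdf_ge0 ?pk//.
    by rewrite !mulr_ge0 ?exprn_ge0 ?invr_ge0 ?ltW.
  have -> : (n%:R^-1 ^+ 2 * T * y 0%N ^+ 2) ^+ 4 = M * y 0%N ^+ 8 by rewrite /M; ring.
  rewrite ler_piMr ?(ltW M0)// exprn_ile1 ?(ltW (y0 _))// /y expR0 mul1r invf_le1//.
  by lra.
(* Edges are compared with the next threshold, and y at k + 1 is e times y at k, whence the factor
   e^8. *)
- apply: (@le_trans _ _ (\sum_(k < N) M * expR 8 * (y k ^+ 8 * expR (- c1 * y k)))).
    apply: ler_sum => k _.
    have kN : (k.+1 <= N)%N by [].
    have -> : M * expR 8 * (y k ^+ 8 * expR (- c1 * y k)) =
       expR (- c1 * y k) * (n%:R^-1 ^+ 2 * T * y k.+1 ^+ 2) ^+ 4.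
      have -> : y k.+1 = expR 1 * y k by rewrite /y -natr1 expRD; ring.
      have -> : expR 8 = expR 1 ^+ 8 :> R by rewrite -expRM_natl mulr1.
      by rewrite /M; ring.
    apply: ler_pM.
    + by rewrite exprn_ge0// subr_ge0 normal_cdf_le1.
    + by rewrite exprn_ge0// normal_cdf_ge0.
    + by apply: qk; exact: ltnW.
    + apply: lerXn2r; rewrite ?nnegrE ?normal_cdf_ge0 ?pk//.
      by rewrite !mulr_ge0 ?exprn_ge0 ?invr_ge0 ?ltW.
  rewrite -mulr_sumr -mulrA ler_pM2l// ler_pM2l ?expR_gt0//.
  by apply: C1P; rewrite invr_gt0.
(* As N > T - 1, y_N is at least exp(T - 1)/T, and the double exponential beats n^-8 =
   exp(-4T^2). *)
- apply: (le_trans (qk _ (leqnn _))).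
  apply: (@le_trans _ _ (expR (- c1 * (expR (T - 1) / T)))).
    rewrite ler_expR !mulNr lerN2 ler_pM2l// ler_pM2r ?invr_gt0// ler_expR.
    by rewrite lerBlDr natr1 ltW.
  apply: (le_trans (C2P _ T0)); rewrite mulrC ler_pM2r//.
  have -> : expR (- (4 * T ^+ 2)) = n%:R^-1 ^+ 8.
    by rewrite -En -expRM_natl; congr expR; field.
  rewrite ler_pMr ?exprn_gt0 ?invr_gt0//.
  by rewrite exprn_ege1//; lra.
Qed.

End estimates.

(** * The probability of a tree with four edges *)

Section tree_event.
Context {R : realType}.

Lemma probability_setU_le d (T : measurableType d) (P : probability T R) (A B : set T) :
  measurable A -> measurable B -> (P (A `|` B) <= P A + P B)%E.
Proof. exact: measureU2. Qed.

Lemma measure_bigsetU_le d (T : measurableType d) (P : probability T R) (I : Type)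
    (s : seq I) (F : I -> set T) : (forall i, measurable (F i)) ->
  (P (\big[setU/set0]_(i <- s) F i) <= \sum_(i <- s) P (F i))%E.
Proof.
move=> mF; elim: s => [|i s IH]; first by rewrite !big_nil measure0.
rewrite !big_cons; apply: le_trans (leeD2l _ IH).
apply: probability_setU_le => //.
exact: bigsetU_measurable.
Qed.

Lemma prod_setU_const (I : finType) (A B : {set I}) (c : pred I) (a b : R) :
  (forall i, i \in A -> c i) -> (forall i, i \in B -> ~~ c i) ->
  \prod_(i in (A :|: B)%SET) (if c i then a else b) = a ^+ #|A| * b ^+ #|B|.
Proof.
move=> cA cB; rewrite (bigID c) /= -!prodr_const; congr (_ * _).
- rewrite (eq_bigr (fun=> a)); last by move=> i /andP[_ ->].
  apply: eq_bigl => i; rewrite finset.in_setU.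
  have [iA|iA] := boolP (i \in A); first by rewrite cA.
  by have [iB|//] := boolP (i \in B); rewrite (negbTE (cB _ iB)).
- rewrite (eq_bigr (fun=> b)); last by move=> i /andP[_ /negbTE ->].
  apply: eq_bigl => i; rewrite finset.in_setU.
  have [iB|iB] := boolP (i \in B); first by rewrite orbT cB.
  by have [iA|//] := boolP (i \in A); rewrite cA.
Qed.

Lemma card_diag_pairs m : #|((fun i : 'I_m => (i, i)) @: 'I_m)%SET| = m.
Proof. by rewrite card_imset ?card_ord// => i j [->]. Qed.

Context d (Omega : measurableType d) (P : probability Omega R) (n : nat).
Context (Q : 'I_n -> 'I_n -> {RV P >-> R}).
Hypothesis GOE : is_GOE Q.

(** * The slices of one fixed tree *)

Section edges.
Context (u : 'I_5 -> 'I_n) (p : 'I_4 -> 'I_5).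
Hypothesis uinj : injective u.
Hypothesis ple : forall k, (p k <= k)%N.

(** The endpoints are sorted because independence is stated for positions on or above the
    diagonal. *)
Definition tree_edge (k : 'I_4) : 'I_n * 'I_n :=
  if (u (p k) <= u (lift ord0 k))%N then (u (p k), u (lift ord0 k))
  else (u (lift ord0 k), u (p k)).

Lemma tree_edge_le k : ((tree_edge k).1 <= (tree_edge k).2)%N.
Proof. by rewrite /tree_edge; case: ifPn => //=; rewrite -ltnNge; exact: ltnW. Qed.

Lemma tree_edge_neq k : (tree_edge k).1 != (tree_edge k).2.
Proof.
have H : p k != lift ord0 k.
  by apply/eqP => /(congr1 val) /= H; have := ple k; rewrite H /bump /= add1n ltnn.
by rewrite /tree_edge; case: ifP => _ /=; [|rewrite eq_sym];
  apply: contra H => /eqP /uinj ->.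
Qed.

(** An edge is determined by its later vertex: for k <= l, vertex l + 1 comes after the parent of k
    + 1, so it can only be k + 1. *)
Lemma tree_edge_inj : injective tree_edge.
Proof.
move=> k l.
wlog kl : k l / (k <= l)%N.
  by move=> H e; have [kl|/ltnW lk] := leqP k l; [exact: H|apply/esym/H].
move=> e.
have {e} : u (lift ord0 l) = u (p k) \/ u (lift ord0 l) = u (lift ord0 k).
  by move: e; rewrite /tree_edge; case: ifP => _; case: ifP => _ [e1 e2];
    rewrite ?e1 ?e2; [right|left|left|right].
case=> /uinj /(congr1 val); rewrite /= /bump /= !add1n.
  by move=> e; have := leq_trans (ple k) kl; rewrite -e ltnn.
by move=> [e]; apply: val_inj.
Qed.

Lemma random_matrix_tree_edge w k :
  random_matrix Q w (u (p k)) (u (lift ord0 k)) = Q (tree_edge k).1 (tree_edge k).2 w.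
Proof.
have [Qsym _ _ _] := GOE; rewrite /tree_edge; case: ifP => _; first by rewrite mxE.
by have := Qsym w => /matrixP/(_ (u (p k)) (u (lift ord0 k))) <-; rewrite !mxE.
Qed.

Definition rectangle (A B : set R) : set Omega :=
  [set w | (forall i, A (Q i i w)) /\
           (forall k, B (Q (tree_edge k).1 (tree_edge k).2 w))].

Lemma rectangleE A B (J := ((fun i : 'I_n => (i, i)) @: 'I_n :|: tree_edge @: 'I_4)%SET) :
  rectangle A B = \bigcap_(i in [set` J]) ((Q i.1 i.2) @^-1` (if i.1 == i.2 then A else B)).
Proof.
apply/seteqP; split => w /=.
  move=> [wA wB] i /=; rewrite finset.in_setU => /orP[/imsetP[j _ ->]|/imsetP[k _ ->]] /=.
    by rewrite eqxx.
  by rewrite (negbTE (tree_edge_neq k)).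
move=> H; split => [i|k].
  have := H (i, i); rewrite /= eqxx; apply.
  by rewrite finset.in_setU imset_f.
have := H (tree_edge k); rewrite /= (negbTE (tree_edge_neq k)); apply.
by rewrite finset.in_setU imset_f ?orbT.
Qed.

Lemma rectangle_measurable A B : measurable A -> measurable B -> measurable (rectangle A B).
Proof.
move=> mA mB; rewrite rectangleE; apply: fin_bigcap_measurable => [|i _].
  exact: finite_finset.
rewrite -[X in measurable X]setTI; apply: (measurable_funPT (Q i.1 i.2)) => //.
by case: ifP.
Qed.

(** The diagonal and the four edges occupy n + 4 distinct positions, so independence gives a
    product. *)
Lemma rectangle_prob A B a b : measurable A -> measurable B ->
  normal_prob 0 (Num.sqrt 1) A = a%:E -> normal_prob 0 (Num.sqrt 2^-1) B = b%:E ->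
  P (rectangle A B) = (a ^+ n * b ^+ 4)%:E.
Proof.
move=> mA mB Aa Bb; have [_ Qdiag Qoff Qind] := GOE.
rewrite rectangleE.
set J := (_ :|: _)%SET.
have Jle i : i \in J -> (i.1 <= i.2)%N.
  rewrite finset.in_setU => /orP[/imsetP[j _ ->]|/imsetP[k _ ->]] //=.
  exact: tree_edge_le.
rewrite (Qind J (fun i => if i.1 == i.2 then A else B)); last 2 first.
- by apply/fintype.subsetP => i /Jle; rewrite inE.
- by move=> i _; case: ifP.
rewrite (eq_bigr (fun i : 'I_n * 'I_n => (if i.1 == i.2 then a else b)%:E)); last first.
  move=> i iJ; case: ifPn => [/eqP ii|ii].
    by rewrite -[LHS]/(distribution P (Q i.1 i.2) A) -ii Qdiag.
  rewrite -[LHS]/(distribution P (Q i.1 i.2) B) Qoff//.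
  by rewrite ltn_neqAle ii Jle.
rewrite -(big_morph EFin (fun x y => EFinM x y) erefl); congr EFin.
rewrite (@prod_setU_const _ _ _ (fun i : 'I_n * 'I_n => i.1 == i.2)).
- by rewrite card_diag_pairs card_imset ?card_ord//; exact: tree_edge_inj.
- by move=> i /imsetP[j _ ->] /=.
- by move=> i /imsetP[k _ ->]; exact: tree_edge_neq.
Qed.

Definition slices (N : nat) (a : nat -> R) : set Omega :=
  rectangle setT `]-oo, a 0%N[ `|`
  \big[setU/set0]_(k < N) rectangle `[a k, +oo[ `]-oo, a k.+1[ `|`
  rectangle `[a N, +oo[ setT.

Lemma slices_measurable N a : measurable (slices N a).
Proof.
apply: measurableU; first apply: measurableU.
- exact: rectangle_measurable.
- by apply: bigsetU_measurable => k _; exact: rectangle_measurable.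
- exact: rectangle_measurable.
Qed.

Lemma slices_prob N a : (P (slices N a) <= (slicing_sum n N a)%:E)%E.
Proof.
have cdfC (x : R) : normal_prob 0 (Num.sqrt 1) `[x, +oo[ =
    (1 - normal_cdf (Num.sqrt 1) x)%:E.
  rewrite -setCitvl (_ : normal_prob 0 _ _ = (1 - normal_prob 0 (Num.sqrt 1) `]-oo, x[)%E).
    by rewrite normal_cdfE -EFinB.
  exact: probability_setC.
have mN (x : R) : measurable `]-oo, x[%classic by exact: measurable_itv.
have mP (x : R) : measurable `[x, +oo[%classic by exact: measurable_itv.
have cdfT (s : R) : normal_prob 0 s setT = 1%:E by exact: probability_setT.
have mB : measurable (\big[setU/set0]_(k < N) rectangle `[a k, +oo[ `]-oo, a k.+1[).
  by apply: bigsetU_measurable => k _; exact: rectangle_measurable.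
have m0 : measurable (rectangle setT `]-oo, a 0%N[) by exact: rectangle_measurable.
have m1 : measurable (rectangle `[a N, +oo[ setT) by exact: rectangle_measurable.
have P0 : P (rectangle setT `]-oo, a 0%N[) = (normal_cdf (Num.sqrt 2^-1) (a 0%N) ^+ 4)%:E.
  by rewrite (rectangle_prob measurableT (mN _) (cdfT _) (normal_cdfE _ _)) expr1n mul1r.
have P1 : P (rectangle `[a N, +oo[ setT) = ((1 - normal_cdf (Num.sqrt 1) (a N)) ^+ n)%:E.
  by rewrite (rectangle_prob (mP _) measurableT (cdfC _) (cdfT _)) expr1n mulr1.
have PB k : P (rectangle `[a k, +oo[ `]-oo, a k.+1[) =
    ((1 - normal_cdf (Num.sqrt 1) (a k)) ^+ n * normal_cdf (Num.sqrt 2^-1) (a k.+1) ^+ 4)%:E.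
  exact: (rectangle_prob (mP _) (mN _) (cdfC _) (normal_cdfE _ _)).
rewrite /slicing_sum !EFinD -P0 -P1 -sumEFin.
apply: (le_trans (probability_setU_le _ (measurableU _ _ m0 mB) m1)); apply: leeD2r.
apply: (le_trans (probability_setU_le _ m0 mB)); apply: leeD2l.
under [leRHS]eq_bigr do rewrite -PB.
by apply: measure_bigsetU_le => k; exact: rectangle_measurable.
Qed.

(** If no diagonal entry is below [a N], the last set applies. Otherwise take the least l with a
    diagonal entry below [a l]: the edges, smaller than the whole diagonal, are below [a l] too, and
    for l > 0 the diagonal stays above the preceding threshold. *)
Lemma tree5_slices N a w :
  (forall k, below_diag (random_matrix Q w) (u (p k)) (u (lift ord0 k))) ->
  slices N a w.
Proof.
move=> H.
have {}H k i : Q (tree_edge k).1 (tree_edge k).2 w < Q i i w.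
  have /andP[_ /forallP/(_ i)] := H k.
  by rewrite random_matrix_tree_edge mxE.
pose low l := `[< exists i, Q i i w < a l >].
have nlow l : ~~ low l -> forall i, a l <= Q i i w.
  by move=> /asboolPn nl i; rewrite leNgt; apply/negP => il; apply: nl; exists i.
have rlow l : low l -> forall k, Q (tree_edge k).1 (tree_edge k).2 w < a l.
  by move=> /asboolP[i il] k; exact: lt_trans (H k i) il.
have [lN|lN] := boolP (low N); last first.
  right; split => [i|//] /=; rewrite in_itv /= andbT; exact: nlow.
left; have exl : exists l, low l by exists N.
have minl := ex_minnP exl; move: minl => [[|m] lm mmin].
  by left; split => // k /=; rewrite in_itv /=; exact: rlow.
right.
have mN : (m < N)%N by exact: mmin.
suff : (\bigcup_(k < N) rectangle `[a k, +oo[ `]-oo, a k.+1[) w by rewrite bigcup_mkord.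
exists m => //=; split => [i|k] /=; rewrite in_itv /= ?andbT.
  by apply: nlow; apply/negP => /mmin; rewrite ltnn.
exact: rlow.
Qed.

End edges.

(** Pairs that do not encode a tree get the empty set, so the union runs over a full finite type,
    with n^5 5^4 elements. *)
Definition tree_slices N a (t : {ffun 'I_5 -> 'I_n} * {ffun 'I_4 -> 'I_5}) : set Omega :=
  if injectiveb t.1 && [forall k : 'I_4, t.2 k <= k]%N then slices t.1 t.2 N a else set0.

Lemma tree_slices_measurable N a t : measurable (tree_slices N a t).
Proof.
rewrite /tree_slices; case: ifPn => // /andP[/injectiveP uinj /forallP ple].
exact: slices_measurable.
Qed.

Lemma slicing_sum_ge0 m N (a : nat -> R) : 0 <= slicing_sum m N a.
Proof.
have H s x : 0 <= 1 - normal_cdf s x :> R by rewrite subr_ge0 normal_cdf_le1.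
rewrite /slicing_sum !addr_ge0 ?exprn_ge0 ?normal_cdf_ge0//.
by apply: sumr_ge0 => k _; rewrite mulr_ge0 ?exprn_ge0 ?normal_cdf_ge0.
Qed.

Lemma tree_slices_prob N a :
  (P (\big[setU/set0]_t tree_slices N a t) <=
   (n%:R ^+ 5 * 5 ^+ 4 * slicing_sum n N a)%:E)%E.
Proof.
apply: (le_trans (measure_bigsetU_le _ _ _)); first exact: tree_slices_measurable.
apply: (@le_trans _ _ (\sum_(t : {ffun 'I_5 -> 'I_n} * {ffun 'I_4 -> 'I_5})
    (slicing_sum n N a)%:E))%E.
  apply: lee_sum => t _; rewrite /tree_slices; case: ifPn => [/andP[/injectiveP uinj /forallP
    ple]|_].
    exact: slices_prob.
  by rewrite measure0 lee_fin slicing_sum_ge0.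
rewrite sumEFin sumr_const card_prod !card_ffun !card_ord -[_ *+ _]mulr_natl.
by rewrite natrM !natrX.
Qed.

Lemma exact_outside_tree_slices N a w : (0 < n)%N ->
  ~ (\big[setU/set0]_t tree_slices N a t) w -> dnn_exact (random_matrix Q w).
Proof.
move=> n0 H; have [Qsym _ _ _] := GOE.
apply: dnn_exact_no_tree5 => // u p; apply/negP => /andP[uinj /forallP up]; apply: H.
rewrite (bigD1 (u, p))//=; left.
rewrite /tree_slices /= uinj /=.
have ple : [forall k : 'I_4, p k <= k]%N by apply/forallP => k; have /andP[] := up k.
rewrite ple; apply: tree5_slices => //.
by move=> k; have /andP[] := up k.
Qed.

End tree_event.

(** * Combination of uniqueness, exactness and the tail bound *)

Section main.
Context {R : realType}.

Lemma events_measurable d (Omega : measurableType d) (P : probability Omega R) n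
    (Q : 'I_n -> 'I_n -> {RV P >-> R}) : (0 < n)%N ->
  [/\ measurable [set w | exists X, unique (dnn_optimizer (random_matrix Q w)) X],
      measurable [set w | dnn_exact (random_matrix Q w)] &
      measurable [set w | stqp_unique (random_matrix Q w)]].
Proof.
move=> n0.
have mQ i j : measurable_fun setT (Q i j) by exact: measurable_funPT.
have R1c := @dnn_rank_one_compact R n; have R1n := @dnn_rank_one_neq0 R n n0.
have Dc := @dnn_feasible_compact R n.
have Dn : @dnn_feasible R n !=set0 by have [X [fX _]] := R1n; exists X.
have Db := @dnn_feasible_box R n.
have R1b : @dnn_rank_one R n `<=` @box01 R n by move=> X [/Db].
have Ds X : @dnn_feasible R n X -> X^T = X by move=> [_ [XT _] _].
split.
- exact: (unique_minimizer_measurable (q := fun i j => Q i j)).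
- rewrite (_ : mkset _ = [set w | dnn_value (random_matrix Q w) <= stqp_value (random_matrix
  Q w)] `&`
     [set w | stqp_value (random_matrix Q w) <= dnn_value (random_matrix Q w)]).
    have m1 : measurable_fun setT (fun w => dnn_value (random_matrix Q w)).
      exact: (min_value_measurable (q := fun i j => Q i j)).
    have m2 : measurable_fun setT (fun w => stqp_value (random_matrix Q w)).
      under [fun w => _]eq_fun do rewrite stqp_valueE.
      exact: (min_value_measurable (q := fun i j => Q i j)).
    by apply: measurableI; exact: measurable_le_set.
  apply/seteqP; split => w; rewrite /= /dnn_exact; first by move=> ->; rewrite lexx.
  by move=> [H1 H2]; apply/eqP; rewrite eq_le H1.
- rewrite (_ : mkset _ = [set w | exists X, unique (minimizer (@dnn_rank_one R n) (mxdot
  (random_matrix Q w))) X]).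
    by apply: (unique_minimizer_measurable (q := fun i j => Q i j)) => // X [/Ds].
  by apply/seteqP; split => w /= /stqp_uniqueE.
Qed.

(** The complement of [V] lies in the union of [S] and the null event where uniqueness fails. *)
Lemma good_event_prob d (Omega : measurableType d) (P : probability Omega R) n
    (Q : 'I_n -> 'I_n -> {RV P >-> R}) (S V : set Omega) (b : R) :
  (0 < n)%N -> is_GOE Q -> measurable S -> measurable V -> (P S <= b%:E)%E ->
  (forall w, ~ S w -> dnn_exact (random_matrix Q w)) ->
  (forall w, (exists X, unique (dnn_optimizer (random_matrix Q w)) X) ->
             dnn_exact (random_matrix Q w) -> V w) ->
  ((1 - b)%:E <= P V)%E.
Proof.
move=> n0 GOE mS mV PS Sex UV.
have [mU _ _] := events_measurable Q n0.
set U := (X in measurable X) in mU.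
have PU : P (~` U) = 0%E.
  have [X [fX _]] := @dnn_rank_one_neq0 R n n0.
  apply: unique_minimizer_as => //.
  - exact: dnn_feasible_compact.
  - by exists X.
  - exact: dnn_feasible_box.
  - by move=> Y [_ [YT _] _].
have PVC : (P (~` V) <= b%:E)%E.
  apply: (@le_trans _ _ (P (~` U `|` S))).
    apply: le_measure; rewrite ?inE; [exact: measurableC|by apply: measurableU => //; exact:
      measurableC|].
    move=> w nV; apply: contrapT => /not_orP[nU nS]; apply: nV; apply: UV (Sex _ nS).
    exact: contrapT.
  apply: (le_trans (probability_setU_le _ _ _)) => //; first exact: measurableC.
  by rewrite PU add0e.
move: PVC; rewrite probability_setC// -[P V]fineK ?fin_num_measure//.
by rewrite -EFinB !lee_fin; lra.
Qed.

(** The event [V] stands for either event of the theorem. For large n, the n^5 5^4 trees turn (ln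
    n)^2/n^8 into (ln n)^2/n^3; small n are treated apart. *)
Lemma exact_event_prob : exists K : R, forall n, (0 < n)%N ->
  forall d (Omega : measurableType d) (P : probability Omega R)
    (Q : 'I_n -> 'I_n -> {RV P >-> R}), is_GOE Q ->
  forall V : set Omega, measurable V ->
  (forall w, (exists X, unique (dnn_optimizer (random_matrix Q w)) X) ->
             dnn_exact (random_matrix Q w) -> V w) ->
  ((1 - K * ln (n%:R : R) ^+ 2 / n%:R ^+ 3)%:E <= P V)%E.
Proof.
have [C [n0 [C0 HC]]] := @slicing_sum_le R.
have l2 : 0 < ln 2 :> R by rewrite ln_gt0// ltr1n.
(* For 1 < n < n0 this constant makes the bound trivial, as ln 2 <= ln n and n <= n0. *)
pose K1 : R := n0%:R ^+ 3 / ln 2 ^+ 2.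
have K10 : 0 <= K1 by rewrite divr_ge0// exprn_ge0// ltW.
have K20 : 0 <= 5 ^+ 4 * C by rewrite mulr_ge0 ?exprn_ge0// ltW.
exists (K1 + 5 ^+ 4 * C) => n n_gt0 d Omega P Q GOE V mV UV.
have n_gt0' : 0 < n%:R :> R by rewrite ltr0n.
have r0 : 0 <= ln (n%:R : R) ^+ 2 / n%:R ^+ 3.
  by rewrite divr_ge0 ?sqr_ge0// exprn_ge0// ltW.
have [n1|n1] := leqP n 1.
  (* Here ln 1 = 0, so probability 1 is required; it holds because five distinct vertices do not
     exist. *)
  have {n1} n1 : n = 1%N by apply/eqP; rewrite eqn_leq n1.
  subst n; rewrite ln1 expr0n /= mulr0 mul0r.
  apply: (@good_event_prob _ _ P 1 Q set0 V 0) => //; first by rewrite measure0.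
  move=> w _; have [Qsym _ _ _] := GOE; apply: dnn_exact_no_tree5 => // u p.
  apply/negP => /andP[/injectiveP uinj _].
  by have := uinj ord0 ord_max; rewrite !ord1 => /(_ erefl) /(congr1 val).
have [nn0|nn0] := leqP n0 n; last first.
  apply: (@le_trans _ _ 0%E) => //; rewrite lee_fin subr_le0.
  rewrite -mulrA mulrDl.
  apply: (@le_trans _ _ (K1 * (ln n%:R ^+ 2 / n%:R ^+ 3))); last first.
    by rewrite lerDl mulr_ge0.
  have H1 : ln 2 ^+ 2 <= ln n%:R ^+ 2 :> R.
    apply: lerXn2r; rewrite ?nnegrE ?(ltW l2)//.
      by rewrite ln_ge0// ler1n.
    by rewrite ler_ln ?posrE// ler_nat.
  have H2 : n%:R ^+ 3 <= n0%:R ^+ 3 :> R.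
    by apply: lerXn2r; rewrite ?nnegrE// ler_nat ltnW.
  rewrite mulrA ler_pdivlMr ?exprn_gt0// mul1r; apply: (le_trans H2).
  rewrite /K1 mulrAC ler_pdivlMr ?exprn_gt0//.
  by rewrite ler_wpM2l// exprn_ge0.
have [N [a Na]] := HC n nn0.
pose S : set Omega := \big[setU/set0]_t @tree_slices R _ _ P n Q N a t.
have mS : measurable S by apply: bigsetU_measurable => t _; exact: tree_slices_measurable.
apply: (@le_trans _ _ (1 - n%:R ^+ 5 * 5 ^+ 4 * slicing_sum n N a)%:E).
  rewrite lee_fin lerD2l lerN2.
  apply: (@le_trans _ _ (n%:R ^+ 5 * 5 ^+ 4 * (C * (ln n%:R ^+ 2 / n%:R ^+ 8)))).
    by rewrite ler_wpM2l// mulr_ge0 ?exprn_ge0.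
  have -> : n%:R ^+ 5 * 5 ^+ 4 * (C * (ln n%:R ^+ 2 / n%:R ^+ 8)) =
     5 ^+ 4 * C * (ln n%:R ^+ 2 / n%:R ^+ 3) :> R.
    by field; rewrite gt_eqF.
  by rewrite -[leRHS]mulrA ler_wpM2r// lerDr.
apply: (@good_event_prob _ _ P n Q S V) => //.
- exact: tree_slices_prob.
- by move=> w Sw; exact: exact_outside_tree_slices Sw.
Qed.

End main.

Theorem theorem2p4 (R : realType) :
  exists K : R,
    forall (n : nat), (0 < n)%N ->
    forall (d : measure_display) (Omega : measurableType d)
      (P : probability Omega R) (Q : 'I_n -> 'I_n -> {RV P >-> R}),
      is_GOE Q ->
      let p := 1 - K * ln (n%:R : R) ^+ 2 / n%:R ^+ 3 in
      let E1 := [set w : Omega | dnn_unique_rank_one (random_matrix Q w)] in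
      let E2 := [set w : Omega | dnn_exact (random_matrix Q w) /\
                                 stqp_unique (random_matrix Q w)] in
      [/\ measurable E1, (p%:E <= P E1)%E,
          measurable E2 & (p%:E <= P E2)%E].
Proof.
have [K HK] := @exact_event_prob R.
exists K => n n0 d Omega P Q GOE p E1 E2.
have [mU mX mS] := events_measurable Q n0.
have mE1 : measurable E1.
  rewrite (_ : E1 = [set w | exists X, unique (dnn_optimizer (random_matrix Q w)) X] `&`
    [set w | dnn_exact (random_matrix Q w)]); first exact: measurableI.
  by apply/seteqP; split => w /= /(dnn_unique_rank_oneE _ n0).
have mE2 : measurable E2 by exact: measurableI.
split => //.
- by apply: (HK n n0 d Omega P Q GOE) => // w U X; apply/dnn_unique_rank_oneE.
- by apply: (HK n n0 d Omega P Q GOE) => // w U X; split => //; exact: dnn_unique_exact_stqp.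
Qed.
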